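(* Let $\varphi\in L^2(\mathbb{R}\times\mathbb{R}^+)$, let $J\subseteq\mathbb{N}$, and let $\{g_n\}_{n\in J}$ be an orthonormal sequence (or a Riesz sequence) of functions in $L^2(\mathbb{R}^+)$ such that, for all $n\in J$ and for almost every $(\omega,r)\in\mathbb{R}\times\mathbb{R}^+$, $$|R_{\mathcal{M}}g_n(\omega,r)|\le|\varphi(\omega,r)|.$$ Then the sequence $\{g_n\}_{n\in J}$ must be finite (that is, $J$ is finite).
   Context: Functions are complex-valued. $\mathbb{R}^+=(0,+\infty)$, $L^2(\mathbb{R}^+)=L^2(\mathbb{R}^+,r^{-1}dr)$, and $L^2(\mathbb{R}\times\mathbb{R}^+)$ is taken with respect to the measure $d\omega\,\frac{dr}{r}$. The Mellin transform is $$\mathcal{M}f(\omega)=\int_0^{+\infty}f(r)r^{-2\pi i\omega}\,\frac{dr}{r},\qquad\omega\in\mathbb{R},$$ understood on $L^2(\mathbb{R}^+)$ in the Plancherel sense, i.e. $\mathcal{M}f$ is the ($L^2$, unitary) Fourier transform, with kernel $e^{-2\pi i\omega x}$, of the function $x\mapsto f(e^x)\in L^2(\mathbb{R})$. The Mellin-Rihaczek distribution of $f\in L^2(\mathbb{R}^+)$ is $$R_{\mathcal{M}}f(\omega,r)=r^{-2\pi i\omega}f(r)\,\overline{\mathcal{M}f(\omega)},\qquad(\omega,r)\in\mathbb{R}\times\mathbb{R}^+.$$ A sequence $\{u_n\}_{n\in J}$ in a Hilbert space $H$ (here $H=L^2(\mathbb{R}^+)$) is a Riesz sequence if there is an invertible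 bounded linear operator $U:H\to H$ with bounded inverse such that $\{U(u_n)\}_{n\in J}$ is an orthonormal sequence in $H$. *)

(* Defs.v *)
From HB Require Import structures.
From mathcomp Require Import all_boot all_order all_algebra.
From mathcomp Require Import complex.
From mathcomp Require Import all_classical all_reals all_analysis.
From mathcomp Require Import measurable_realfun.

Set Implicit Arguments.
Unset Strict Implicit.
Unset Printing Implicit Defensive.

Import Order.TTheory GRing.Theory Num.Theory.
Import numFieldNormedType.Exports.

Local Open Scope classical_set_scope.
Local Open Scope ring_scope.

(* The modulus of a complex number, as an element of R. *)
Notation cmod := (@Normc.normc _).

Section haar_measure.
Local Open Scope ereal_scope.
Context {R : realType}.

(* The measure dr/r on ]0, +oo[, seen as a Borel measure on R for which        *)
(* ]-oo, 0] is negligible: functions on ]0, +oo[ up to a.e. equality are then  *)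
(* the same thing as functions on R up to a.e. equality.                       *)
Definition haar_pos (A : set (measurableTypeR R)) : \bar R :=
  \int[@lebesgue_measure R]_(r in A `&` `]0%R, +oo[) (r^-1)%:E.

Let w : measurableTypeR R -> \bar R :=
  (fun r : R => (r^-1)%:E) \_ `]0%R, +oo[.

Let haar_posE : haar_pos = fun A => \int[@lebesgue_measure R]_(r in A) w r.
Proof. by apply/funext => A; rewrite /haar_pos integral_mkcondr. Qed.

Let w_ge0 r : 0 <= w r.
Proof.
rewrite /w patchE; case: ifPn => //; rewrite inE/= in_itv/= andbT => r0.
by rewrite lee_fin invr_ge0 ltW.
Qed.

Let measurable_w : measurable_fun setT w.
Proof.
apply/(measurable_restrictT _ _).1 => //.
apply/measurable_EFinP; apply: open_continuous_measurable_fun.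
  exact: interval_open.
move=> x; rewrite inE/= in_itv/= andbT => x0.
by apply: inv_continuous; rewrite gt_eqF.
Qed.

Let haar_pos0 : haar_pos set0 = 0.
Proof. by rewrite /haar_pos set0I integral_set0. Qed.

Let haar_pos_ge0 A : 0 <= haar_pos A.
Proof. by rewrite haar_posE; apply: integral_ge0. Qed.

Let haar_pos_sigma_additive : semi_sigma_additive haar_pos.
Proof. by rewrite haar_posE; exact: semi_sigma_additive_nng_induced. Qed.

HB.instance Definition _ := isMeasure.Build _ _ _ haar_pos
  haar_pos0 haar_pos_ge0 haar_pos_sigma_additive.

Let haar_pos_sigma_finite : sigma_finite setT haar_pos.
Proof.
pose G k : set (measurableTypeR R) := `[(k.+1%:R^-1)%R, k.+1%:R%R]%classic.
pose F k : set (measurableTypeR R) := `]-oo, 0%R]%classic `|` G k.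
exists F.
- apply/esym/seteqP; split => // x _; have [x0|x0] := leP x 0%R.
    by exists 0%N => //; left; rewrite /= in_itv.
  exists (maxn (Num.truncn x) (Num.truncn x^-1)) => //; right; rewrite /G /= in_itv/=.
  apply/andP; split.
    rewrite -[leRHS]invrK lef_pV2 ?posrE ?invr_gt0//.
    by apply: (le_trans (ltW (truncnS_gt _))); rewrite ler_nat ltnS leq_maxr.
  by apply: (le_trans (ltW (truncnS_gt _))); rewrite ler_nat ltnS leq_maxl.
- move=> k; split; first by apply: measurableU; exact: measurable_itv.
  have -> : haar_pos (F k) =
      \int[@lebesgue_measure R]_(r in G k) w r.
    rewrite /haar_pos (_ : _ `&` _ = G k); last first.
      apply/seteqP; split => x /=; rewrite /G /= !in_itv/= andbT.
        by case=> -[x1|//]; move: x1; rewrite /= in_itv/= => x1 x2; have := le_lt_trans x1 x2; rewrite ltxx.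
        move=> x12; split; [by right | case/andP: x12 => x1 _; exact: lt_le_trans x1].
    apply: eq_integral => r; rewrite inE /G /= in_itv/= => /andP[r1 _].
    by rewrite /w patchE ifT// inE/= in_itv/= andbT (lt_le_trans _ r1).
  apply: (@le_lt_trans _ _ (\int[@lebesgue_measure R]_(r in G k) (k.+1%:R)%:E)).
    apply: ge0_le_integral => //.
    + exact: measurable_itv.
    + exact: measurable_funTS.
    + move=> r /=; rewrite /G /= in_itv/= => /andP[r1 _].
      have r0 : (0 < r)%R by exact: lt_le_trans r1.
      rewrite /w patchE ifT; last by rewrite inE/= in_itv/= r0.
      by rewrite lee_fin -[leRHS]invrK lef_pV2// ?posrE ?invr_gt0.
  rewrite integral_cst; last exact: measurable_itv.
  apply: lte_mul_pinfty => //.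
  suff : (@lebesgue_measure R) (G k) < +oo by [].
  rewrite /G lebesgue_measure_itv/=.
  by case: ifPn => _; rewrite -?EFinB ltry.
Qed.

HB.instance Definition _ := Measure_isSigmaFinite.Build _ _ _ haar_pos
  haar_pos_sigma_finite.

End haar_measure.

Section complex_Lp.
Context d (T : measurableType d) (R : realType).
Implicit Types (mu : {measure set T -> \bar R}) (f g : T -> R[i]).

Definition cmeasurable f :=
  measurable_fun [set: T] (fun x => complex.Re (f x)) /\
  measurable_fun [set: T] (fun x => complex.Im (f x)).

Definition cLnorm mu (p : \bar R) f : \bar R :=
  Lnorm mu p (fun x => (cmod (f x))%:E).

Definition cLfun mu (p : \bar R) f : Prop :=
  cmeasurable f /\ (cLnorm mu p f < +oo)%E.

Definition cintegral mu f : R[i] :=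
  Complex (Rintegral mu [set: T] (fun x => complex.Re (f x)))
          (Rintegral mu [set: T] (fun x => complex.Im (f x))).

Definition cdot mu f g : R[i] := cintegral mu (fun x => f x * conjc (g x)).

(* Elements of L^2 are represented by functions, equality in L^2 being         *)
(* equality a.e.; by linearity and boundedness such a U respects it.           *)
Definition bounded_linear_L2 mu (U : (T -> R[i]) -> (T -> R[i])) : Prop :=
  [/\ forall f, cLfun mu 2%:E f -> cLfun mu 2%:E (U f),
      forall (a : R[i]) f g, cLfun mu 2%:E f -> cLfun mu 2%:E g ->
        U (fun x => a * f x + g x) = (fun x => a * U f x + U g x) %[ae mu]
    & exists C : R, forall f, cLfun mu 2%:E f ->
        (cLnorm mu 2%:E (U f) <= C%:E * cLnorm mu 2%:E f)%E].

Definition orthonormal_sequence mu (J : set nat) (u : nat -> T -> R[i]) : Prop :=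
  (forall n, J n -> cLfun mu 2%:E (u n)) /\
  (forall n m, J n -> J m -> cdot mu (u n) (u m) = (n == m)%:R).

Definition riesz_sequence mu (J : set nat) (u : nat -> T -> R[i]) : Prop :=
  (forall n, J n -> cLfun mu 2%:E (u n)) /\
  exists U V : (T -> R[i]) -> (T -> R[i]),
    [/\ bounded_linear_L2 mu U, bounded_linear_L2 mu V,
        forall f, cLfun mu 2%:E f ->
          V (U f) = f %[ae mu] /\ U (V f) = f %[ae mu]
      & orthonormal_sequence mu J (fun n => U (u n))].

End complex_Lp.

Section mellin.
Context {R : realType}.
Local Notation leb := (@lebesgue_measure R).
Implicit Types h F f : measurableTypeR R -> R[i].

(* e^{i t} *)
Definition cexpi (t : R) : R[i] := Complex (cos t) (sin t).

Definition fourier_integral h : measurableTypeR R -> R[i] := fun omega =>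
  cintegral leb (fun x => h x * cexpi (- (2 * pi * omega * x))).

(* F is the Fourier-Plancherel transform of h: the pair (h, F) is in the       *)
(* L^2-closure of the graph of the Fourier integral on L^1 `&` L^2.            *)
Definition is_fourierL2 h F : Prop :=
  [/\ cLfun leb 2%:E h, cLfun leb 2%:E F &
   exists h_ : nat -> measurableTypeR R -> R[i],
     [/\ forall k, cLfun leb 1%:E (h_ k) /\ cLfun leb 2%:E (h_ k),
         cLnorm leb 2%:E (fun x => h_ k x - h x) @[k --> \oo] --> 0%E
       & cLnorm leb 2%:E (fun x => fourier_integral (h_ k) x - F x)
           @[k --> \oo] --> 0%E]].

(* A representative, determined up to a.e. equality when h is in L^2; the      *)
(* default value only concerns functions h that are not in L^2.                *)
Definition fourierL2 h : measurableTypeR R -> R[i] :=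
  xget (fun=> 0) [set F | is_fourierL2 h F].

Definition mellin f : measurableTypeR R -> R[i] :=
  fourierL2 (fun x => f (expR x)).

(* Only meaningful for 0 < r, where r ^ (- 2 pi i omega) is                    *)
(* e ^ (- 2 pi i omega ln r).                                                  *)
Definition mellin_rihaczek f (omega r : R) : R[i] :=
  cexpi (- (2 * pi * omega * ln r)) * f r * conjc (mellin f omega).

End mellin.

(* Main.v *)
From HB Require Import structures.
Require Import Defs.
From mathcomp Require Import all_boot all_order all_algebra.
From mathcomp Require Import complex finmap.
From mathcomp Require Import all_classical all_reals all_analysis.
From mathcomp Require Import measurable_realfun.
From mathcomp Require Import ring lra.

(** The domination confines all the g_n to one bounded region of the
    time-frequency plane, and such a region has room for only finitely many
    functions of a Riesz sequence.

    Write h_n (x) = g_n (e^x), a function in L^2 (dx) since the logarithm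
    carries dr/r to dx ([ge0_integral_haar_pos]), and let F_n be its Fourier
    transform, the Mellin transform of g_n.  The modulus of the
    Mellin-Rihaczek distribution is |F_n (omega)| |g_n (r)|, so by Tonelli the
    energy of F_n outside [-T, T] times the energy of g_n, and the energy of
    F_n times the energy of h_n outside [-T, T], are both bounded by the energy
    of phi outside a box.  The latter is small for T large, uniformly in n
    ([tail_energy_cvg0]), whereas the energies of g_n and F_n are bounded below:
    the first because the inverse of a bounded operator is bounded
    ([riesz_lower_bound]), the second by Plancherel ([is_fourierL2_energy]).
    Hence the Fourier transform of h_n truncated to [-T, T], truncated in turn
    to [-T, T], keeps an energy bounded below independently of n
    ([concentration_lower]).  The value of this transform at omega is the inner
    product of h_n with the wave e^(2 pi i omega x) cut to [-T, T], whose energy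
    is 2 T; Bessel's inequality for Riesz sequences ([bessel]) bounds the sum
    over n of the squares of these inner products by a multiple of 2 T, and
    integrating over omega in [-T, T] bounds the sum of the energies
    ([time_frequency_capacity]).  So the number of indices is bounded.

    Squared norms ([energy]) replace norms throughout, and the triangle
    inequality is used in the form |a - b|^2 <= 2 |a|^2 + 2 |b|^2; the constants
    that this costs do not matter.

    The transform of the statement is a limit of Fourier integrals, so its
    existence and its bounds rest on Plancherel's theorem, proved as follows.
    Weighting by exp (- a |omega|) and applying Fubini, the energy of the
    Fourier integral of h becomes the integral of Re (h (x) conj (h (y)))
    against the Poisson kernel at x - y ([abel_energyE]).  Since the kernel has
    total mass one, 2 Re (z conj w) <= |z|^2 + |w|^2 gives the upper bound
    ([fourier_energy_le]) when a tends to 0.  On bounded functions that are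
    continuous on an open interval and vanish outside, the Poisson averages
    converge pointwise, which gives the lower bound ([energy_le_fourier]).
    These functions are dense ([truncated_continuous_dense]); completeness of
    L^2 ([energy_complete]) then yields the transform ([fourierL2_exists]) and
    density extends the two bounds to it. *)

Set Implicit Arguments.
Unset Strict Implicit.
Unset Printing Implicit Defensive.

Import Order.TTheory GRing.Theory Num.Theory.
Import numFieldNormedType.Exports.

Local Open Scope classical_set_scope.
Local Open Scope ring_scope.

(** * Square modulus and energy of complex functions *)

Lemma cvg_EFin_real (R : realType) (T : Type) (F : set_system T) {FF : Filter F}
  (f : T -> R) (a : R) : f x @[x --> F] --> a -> (f x)%:E @[x --> F] --> a%:E.
Proof. by move=> fa; apply: cvg_EFin; [exact: nearW|exact: fa]. Qed.

Section square_modulus.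
Context {R : realType}.
Implicit Types z w : R[i].

Definition csq z : R := complex.Re z ^+ 2 + complex.Im z ^+ 2.

Lemma ReB z w : complex.Re (z - w) = complex.Re z - complex.Re w.
Proof. by case: z w => [? ?] [? ?]. Qed.

Lemma ImB z w : complex.Im (z - w) = complex.Im z - complex.Im w.
Proof. by case: z w => [? ?] [? ?]. Qed.

Lemma csq_ge0 z : 0 <= csq z.
Proof. by rewrite addr_ge0 ?sqr_ge0. Qed.

Lemma csq0 : csq 0 = 0.
Proof. by rewrite /csq/= expr0n addr0. Qed.

Lemma csqM z w : csq (z * w) = csq z * csq w.
Proof. by case: z w => [a b] [c d]; rewrite /csq/=; ring. Qed.

Lemma csqN z : csq (- z) = csq z.
Proof. by case: z => [a b]; rewrite /csq/=; ring. Qed.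

Lemma csqD z w : csq (z + w) =
  csq z + csq w + 2 * complex.Re (z * conjc w).
Proof. by case: z w => [a b] [c d]; rewrite /csq/=; ring. Qed.

Lemma csqB_le z w : csq (z - w) <= 2 * csq z + 2 * csq w.
Proof.
case: z w => [a b] [c d]; rewrite /csq/= -subr_ge0.
rewrite (_ : _ - _ = (a + c) ^+ 2 + (b + d) ^+ 2); first by rewrite addr_ge0 ?sqr_ge0.
by ring.
Qed.

Lemma csq_conjc z : csq (conjc z) = csq z.
Proof. by case: z => [a b]; rewrite /csq/= sqrrN. Qed.

Lemma csq_cexpi t : csq (cexpi t) = 1.
Proof. by rewrite /csq/= cos2Dsin2. Qed.

Lemma cmod_ge0 z : 0 <= cmod z.
Proof. by case: z => a b /=; rewrite sqrtr_ge0. Qed.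

Lemma sqr_cmod z : cmod z ^+ 2 = csq z.
Proof. by case: z => a b /=; rewrite sqr_sqrtr// addr_ge0 ?sqr_ge0. Qed.

Lemma Re_sqr_le z : complex.Re z ^+ 2 <= csq z.
Proof. by rewrite lerDl sqr_ge0. Qed.

Lemma Im_sqr_le z : complex.Im z ^+ 2 <= csq z.
Proof. by rewrite lerDr sqr_ge0. Qed.

Lemma normr_Re_le z : `|complex.Re z| <= cmod z.
Proof.
by rewrite -(@ler_pXn2r _ 2) ?nnegrE ?cmod_ge0// sqr_cmod real_normK ?num_real// Re_sqr_le.
Qed.

Lemma normr_Im_le z : `|complex.Im z| <= cmod z.
Proof.
by rewrite -(@ler_pXn2r _ 2) ?nnegrE ?cmod_ge0// sqr_cmod real_normK ?num_real// Im_sqr_le.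
Qed.

Lemma normr_Re_mul_conjc_le z w : `|complex.Re (z * conjc w)| <= csq z + csq w.
Proof.
case: z w => [a b] [c d]; rewrite /csq/= ler_norml.
have := (sqr_ge0 (a + c), sqr_ge0 (a - c), sqr_ge0 (b + d), sqr_ge0 (b - d)).
move=> [[[]]]; have := (sqr_ge0 a, sqr_ge0 b, sqr_ge0 c, sqr_ge0 d) => -[[[]]].
by move=> *; apply/andP; split; lra.
Qed.

Lemma normr_Im_mul_conjc_le z w : `|complex.Im (z * conjc w)| <= csq z + csq w.
Proof.
case: z w => [a b] [c d]; rewrite /csq/= ler_norml.
have := (sqr_ge0 (a + d), sqr_ge0 (a - d), sqr_ge0 (b + c), sqr_ge0 (b - c)).
move=> [[[]]]; have := (sqr_ge0 a, sqr_ge0 b, sqr_ge0 c, sqr_ge0 d) => -[[[]]].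
by move=> *; apply/andP; split; lra.
Qed.

End square_modulus.

Section complex_measurable.
Context d (T : measurableType d) (R : realType).
Implicit Types f g : T -> R[i].

Lemma cmeasurable_cst (z : R[i]) : @cmeasurable d T R (fun=> z).
Proof. by split; exact: measurable_cst. Qed.

Lemma cmeasurableD f g : cmeasurable f -> cmeasurable g ->
  cmeasurable (fun x => f x + g x).
Proof.
move=> [f1 f2] [g1 g2]; split.
  rewrite (_ : (fun _ => _) = (fun x => complex.Re (f x) + complex.Re (g x))).
    exact: measurable_funD.
  by apply/funext => x; case: (f x) (g x) => [? ?] [? ?].
rewrite (_ : (fun _ => _) = (fun x => complex.Im (f x) + complex.Im (g x))).
  exact: measurable_funD.
by apply/funext => x; case: (f x) (g x) => [? ?] [? ?].
Qed.

Lemma cmeasurableM f g : cmeasurable f -> cmeasurable g ->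
  cmeasurable (fun x => f x * g x).
Proof.
move=> [f1 f2] [g1 g2]; split.
  rewrite (_ : (fun _ => _) = (fun x => complex.Re (f x) * complex.Re (g x)
      - complex.Im (f x) * complex.Im (g x))).
    by apply: measurable_funB; exact: measurable_funM.
  by apply/funext => x; case: (f x) (g x) => [? ?] [? ?].
rewrite (_ : (fun _ => _) = (fun x => complex.Re (f x) * complex.Im (g x)
      + complex.Im (f x) * complex.Re (g x))).
  by apply: measurable_funD; exact: measurable_funM.
by apply/funext => x; case: (f x) (g x) => [? ?] [? ?].
Qed.

Lemma cmeasurableN f : cmeasurable f -> cmeasurable (fun x => - f x).
Proof.
move=> mf; rewrite (_ : (fun _ => _) = (fun x => -1 * f x)).
  by apply: cmeasurableM => //; exact: cmeasurable_cst.
by apply/funext => x; rewrite mulN1r.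
Qed.

Lemma cmeasurableB f g : cmeasurable f -> cmeasurable g ->
  cmeasurable (fun x => f x - g x).
Proof. by move=> mf mg; apply: cmeasurableD => //; exact: cmeasurableN. Qed.

Lemma cmeasurable_conjc f : cmeasurable f -> cmeasurable (fun x => conjc (f x)).
Proof.
move=> [f1 f2]; split.
  rewrite (_ : (fun _ => _) = (fun x => complex.Re (f x)))//.
  by apply/funext => x; case: (f x).
rewrite (_ : (fun _ => _) = (fun x => - complex.Im (f x))).
  exact: measurable_funN.
by apply/funext => x; case: (f x).
Qed.

Lemma measurable_csq f : cmeasurable f ->
  measurable_fun [set: T] (fun x => csq (f x)).
Proof.
by move=> [f1 f2]; apply: measurable_funD; apply: measurable_funX.
Qed.

End complex_measurable.

Section energy.
Context d (T : measurableType d) (R : realType).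
Variable mu : {measure set T -> \bar R}.
Implicit Types f g : T -> R[i].
Local Open Scope ereal_scope.

Definition energy f : \bar R := \int[mu]_x (csq (f x))%:E.

Lemma energy_ge0 f : 0 <= energy f.
Proof. by apply: integral_ge0 => x _; rewrite lee_fin csq_ge0. Qed.

Lemma measurable_ecsq f : cmeasurable f ->
  measurable_fun [set: T] (fun x => (csq (f x))%:E).
Proof. by move=> mf; apply/measurable_EFinP; exact: measurable_csq. Qed.

Lemma eq_energy f g : f =1 g -> energy f = energy g.
Proof. by move=> fg; apply: eq_integral => x _; rewrite fg. Qed.

Lemma ae_eq_energy f g : cmeasurable f -> cmeasurable g ->
  f = g %[ae mu] -> energy f = energy g.
Proof.
move=> mf mg fg; apply: ge0_ae_eq_integral => //.
- exact: measurable_ecsq.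
- exact: measurable_ecsq.
- by move=> x _; rewrite lee_fin csq_ge0.
- by move=> x _; rewrite lee_fin csq_ge0.
- by apply: filterS fg => x /= fg _; rewrite fg.
Qed.

Lemma energyN f : energy (fun x => - f x)%R = energy f.
Proof. by apply: eq_integral => x _; rewrite csqN. Qed.

Lemma energyBC f g : energy (fun x => f x - g x)%R = energy (fun x => g x - f x)%R.
Proof. by rewrite -energyN; apply: eq_energy => x; rewrite opprB. Qed.

Lemma energyB_le f g : cmeasurable f -> cmeasurable g ->
  energy (fun x => f x - g x)%R <= 2%:E * energy f + 2%:E * energy g.
Proof.
move=> mf mg; rewrite /energy.
rewrite -!ge0_integralZl_EFin//; last 4 first.
- by move=> x _; rewrite lee_fin csq_ge0.
- exact: measurable_ecsq.
- by move=> x _; rewrite lee_fin csq_ge0.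
- exact: measurable_ecsq.
rewrite -ge0_integralD//; last 4 first.
- by move=> x _; rewrite lee_fin mulr_ge0 ?csq_ge0.
- by apply: emeasurable_funM => //; exact: measurable_ecsq.
- by move=> x _; rewrite lee_fin mulr_ge0 ?csq_ge0.
- by apply: emeasurable_funM => //; exact: measurable_ecsq.
apply: ge0_le_integral => //.
- by move=> x _; rewrite lee_fin csq_ge0.
- by apply: measurable_ecsq; exact: cmeasurableB.
- by apply: emeasurable_funD; apply: emeasurable_funM => //; exact: measurable_ecsq.
- by move=> x _; rewrite lee_fin csqB_le.
Qed.

(** The triangle inequality up to a factor 2, in the form used for
    approximation arguments. *)
Lemma energy_le_approx f g : cmeasurable f -> cmeasurable g ->
  energy f <= 2%:E * energy (fun x => f x - g x)%R + 2%:E * energy g.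
Proof.
move=> mf mg; rewrite -(energyN g).
have := @energyB_le (fun x => f x - g x)%R (fun x => - g x)%R
  (cmeasurableB mf mg) (cmeasurableN mg).
apply: le_trans; rewrite le_eqVlt; apply/orP; left; apply/eqP.
by apply: eq_energy => x; rewrite opprK subrK.
Qed.

Lemma energyZ (c : R[i]) f : cmeasurable f ->
  energy (fun x => c * f x)%R = (csq c)%:E * energy f.
Proof.
move=> mf; rewrite /energy -ge0_integralZl_EFin//.
- by apply: eq_integral => x _; rewrite csqM EFinM.
- by move=> x _; rewrite lee_fin csq_ge0.
- exact: measurable_ecsq.
- exact: csq_ge0.
Qed.

Lemma cLnorm_ge0 p f : 0 <= cLnorm mu p f.
Proof. exact: Lnorm_ge0. Qed.

Lemma cLnorm1E f : cLnorm mu 1%:E f = \int[mu]_x (cmod (f x))%:E.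
Proof.
rewrite /cLnorm Lnorm1; apply: eq_integral => x _.
by rewrite gee0_abs ?lee_fin ?cmod_ge0.
Qed.

Lemma cLnorm2_sqr f : cLnorm mu 2%:E f * cLnorm mu 2%:E f = energy f.
Proof.
transitivity (cLnorm mu 2%:E f `^ 2)%E; last first.
  rewrite /cLnorm poweR_Lnorm//; apply: eq_integral => x _.
  by rewrite /= ger0_norm ?cmod_ge0// powR_mulrn ?cmod_ge0// sqr_cmod.
have : 0 <= cLnorm mu 2%:E f by exact: cLnorm_ge0.
case: (cLnorm _ _ _) => [r r0|_|//]; last by rewrite mulyy poweRyr.
by rewrite lee_fin in r0; rewrite poweR_EFin powR_mulrn// expr2 EFinM.
Qed.

Lemma cLfun2P f : cLfun mu 2%:E f <-> cmeasurable f /\ energy f < +oo.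
Proof.
split=> -[mf H]; split=> //; move: H; rewrite -cLnorm2_sqr.
  have : 0 <= cLnorm mu 2%:E f by exact: cLnorm_ge0.
  case: (cLnorm _ _ _) => [r _ _|_|//]; first by rewrite -EFinM ltry.
  by rewrite ltxx.
have : 0 <= cLnorm mu 2%:E f by exact: cLnorm_ge0.
case: (cLnorm _ _ _) => [r _ _|_|//]; first by rewrite ltry.
by rewrite mulyy.
Qed.

Lemma energy_fin_num f : cLfun mu 2%:E f -> energy f \is a fin_num.
Proof. by move=> /cLfun2P[_ ?]; rewrite ge0_fin_numE// energy_ge0. Qed.

Lemma integrable_csq f : cLfun mu 2%:E f ->
  mu.-integrable setT (fun x => (csq (f x))%:E).
Proof.
move=> /cLfun2P[mf fy]; apply/integrableP; split; first exact: measurable_ecsq.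
by under eq_integral do rewrite gee0_abs ?lee_fin ?csq_ge0//.
Qed.

Lemma cLfun2B f g : cLfun mu 2%:E f -> cLfun mu 2%:E g ->
  cLfun mu 2%:E (fun x => f x - g x)%R.
Proof.
move=> /cLfun2P[mf fy] /cLfun2P[mg gy]; apply/cLfun2P; split.
  exact: cmeasurableB.
apply: le_lt_trans (energyB_le mf mg) _.
by rewrite lte_add_pinfty// lte_mul_pinfty.
Qed.

Lemma cLfun2N f : cLfun mu 2%:E f -> cLfun mu 2%:E (fun x => - f x)%R.
Proof.
move=> /cLfun2P[mf fy]; apply/cLfun2P; split; first exact: cmeasurableN.
by rewrite energyN.
Qed.

Lemma cLfun2D f g : cLfun mu 2%:E f -> cLfun mu 2%:E g ->
  cLfun mu 2%:E (fun x => f x + g x)%R.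
Proof.
move=> Lf Lg; have := cLfun2B Lf (cLfun2N Lg).
by under eq_fun do rewrite opprK.
Qed.

Lemma cLfun2Z (c : R[i]) f : cLfun mu 2%:E f -> cLfun mu 2%:E (fun x => c * f x)%R.
Proof.
move=> /cLfun2P[mf fy]; apply/cLfun2P; split.
  by apply: cmeasurableM => //; exact: cmeasurable_cst.
by rewrite energyZ// lte_mul_pinfty// ?lee_fin ?csq_ge0.
Qed.

Lemma cLfun2_0 : cLfun mu 2%:E (fun _ : T => 0%R).
Proof.
apply/cLfun2P; split; first exact: cmeasurable_cst.
by rewrite /energy; under eq_integral do rewrite csq0; rewrite integral0.
Qed.

Lemma cLfun2_sum (I : eqType) (s : seq I) (F : I -> T -> R[i]) :
  (forall i, i \in s -> cLfun mu 2%:E (F i)) ->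
  cLfun mu 2%:E (fun x => \sum_(i <- s) F i x)%R.
Proof.
elim: s => [|i s ih] LF.
  under eq_fun do rewrite big_nil.
  exact: cLfun2_0.
under eq_fun do rewrite big_cons.
apply: cLfun2D; first by apply: LF; rewrite mem_head.
by apply: ih => j js; apply: LF; rewrite inE js orbT.
Qed.

Lemma cvg_cLnorm2_energy (F : nat -> T -> R[i]) :
  cLnorm mu 2%:E (F k) @[k --> \oo] --> 0 <-> energy (F k) @[k --> \oo] --> 0.
Proof.
split=> h.
  have := cvgeM _ h h; rewrite mule0; under eq_fun do rewrite cLnorm2_sqr.
  by apply; exact: mule_def_fin.
apply/fine_cvgP; move/fine_cvgP : h => [hf hc].
have nf : \forall k \near \oo, cLnorm mu 2%:E (F k) \is a fin_num.
  near=> k; have : energy (F k) \is a fin_num by near: k.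
  rewrite -cLnorm2_sqr; have := cLnorm_ge0 2%:E (F k).
  by case: (cLnorm _ _ _) => [r|_|//]; rewrite ?mulyy.
split=> //.
have hs : (fun k => Num.sqrt (fine (energy (F k)))) @ \oo --> (0 : R)%R.
  rewrite -(@sqrtr0 R); apply: continuous_cvg; last exact: hc.
  exact: sqrt_continuous.
apply: cvg_trans hs; apply: near_eq_cvg; near=> k => /=.
have : cLnorm mu 2%:E (F k) \is a fin_num by near: k.
rewrite -cLnorm2_sqr; have := cLnorm_ge0 2%:E (F k).
case: (cLnorm _ _ _) => [r r0 _|_|//]; last by rewrite mulyy.
by rewrite lee_fin in r0; rewrite /= -expr2 sqrtr_sqr ger0_norm.
Unshelve. all: by end_near. Qed.

End energy.

(** * Inner product, Bessel inequality and Riesz sequences *)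

Section inner_product.
Context d (T : measurableType d) (R : realType).
Variable mu : {measure set T -> \bar R}.
Implicit Types f g : T -> R[i].
Local Notation L2 := (cLfun mu 2%:E).

Lemma integrable_Re_mul_conjc f g : L2 f -> L2 g ->
  mu.-integrable setT (EFin \o (fun x => complex.Re (f x * conjc (g x)))).
Proof.
move=> Lf Lg; have [[mf _] [mg _]] := (Lf, Lg).
apply: (le_integrable measurableT _ _
  (integrableD measurableT (integrable_csq Lf) (integrable_csq Lg))).
  by apply/measurable_EFinP; case: (cmeasurableM mf (cmeasurable_conjc mg)).
move=> x _ /=; rewrite lee_fin (le_trans (normr_Re_mul_conjc_le _ _))//.
by rewrite ler_norm.
Qed.

Lemma integrable_Im_mul_conjc f g : L2 f -> L2 g ->
  mu.-integrable setT (EFin \o (fun x => complex.Im (f x * conjc (g x)))).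
Proof.
move=> Lf Lg; have [[mf _] [mg _]] := (Lf, Lg).
apply: (le_integrable measurableT _ _
  (integrableD measurableT (integrable_csq Lf) (integrable_csq Lg))).
  by apply/measurable_EFinP; case: (cmeasurableM mf (cmeasurable_conjc mg)).
move=> x _ /=; rewrite lee_fin (le_trans (normr_Im_mul_conjc_le _ _))//.
by rewrite ler_norm.
Qed.

Lemma cdotDl f1 f2 g : L2 f1 -> L2 f2 -> L2 g ->
  cdot mu (fun x => f1 x + f2 x) g = cdot mu f1 g + cdot mu f2 g.
Proof.
move=> L1 L2 Lg; rewrite /cdot /cintegral; apply/eqP; rewrite eq_complex /=.
apply/andP; split; apply/eqP.
  rewrite -RintegralD//; try exact: integrable_Re_mul_conjc.
  by apply: eq_Rintegral => x _; rewrite mulrDl raddfD.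
rewrite -RintegralD//; try exact: integrable_Im_mul_conjc.
by apply: eq_Rintegral => x _; rewrite mulrDl raddfD.
Qed.

Lemma cdotZl (c : R[i]) f g : L2 f -> L2 g ->
  cdot mu (fun x => c * f x) g = c * cdot mu f g.
Proof.
move=> Lf Lg; case: c => a b; rewrite /cdot /cintegral; apply/eqP.
have iR := integrable_Re_mul_conjc Lf Lg.
have iI := integrable_Im_mul_conjc Lf Lg.
have iZR k : mu.-integrable setT
    (EFin \o (fun x => k * complex.Re (f x * conjc (g x)))).
  exact: (integrableZl measurableT k iR).
have iZI k : mu.-integrable setT
    (EFin \o (fun x => k * complex.Im (f x * conjc (g x)))).
  exact: (integrableZl measurableT k iI).
rewrite eq_complex /= -!RintegralZl//.
apply/andP; split; apply/eqP.
  rewrite -RintegralB//; apply: eq_Rintegral => x _; rewrite -mulrA.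
  by case: (_ * conjc _).
rewrite -RintegralD//; apply: eq_Rintegral => x _; rewrite -mulrA.
by case: (_ * conjc _).
Qed.

Lemma cdotC f g : L2 f -> L2 g -> cdot mu g f = conjc (cdot mu f g).
Proof.
move=> Lf Lg; rewrite /cdot /cintegral /=; apply/eqP; rewrite eq_complex /=.
apply/andP; split; apply/eqP.
  by apply: eq_Rintegral => x _; case: (f x) (g x) => [? ?] [? ?] /=; ring.
rewrite -mulN1r -RintegralZl//; last exact: integrable_Im_mul_conjc.
by apply: eq_Rintegral => x _; case: (f x) (g x) => [? ?] [? ?] /=; ring.
Qed.

Lemma Re_cdot_self f : complex.Re (cdot mu f f) = fine (energy mu f).
Proof.
rewrite /=; congr fine; apply: eq_integral => x _; congr EFin.
by case: (f x) => a b; rewrite /csq /=; ring.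
Qed.

Lemma fine_energyD f g : L2 f -> L2 g ->
  fine (energy mu (fun x => f x + g x)) =
  fine (energy mu f) + fine (energy mu g) + 2 * complex.Re (cdot mu f g).
Proof.
move=> Lf Lg.
have iR := integrable_Re_mul_conjc Lf Lg.
have If : mu.-integrable setT (EFin \o (fun x => csq (f x))) by exact: integrable_csq.
have Ig : mu.-integrable setT (EFin \o (fun x => csq (g x))) by exact: integrable_csq.
rewrite /cdot /= -RintegralZl// -[fine (energy mu f)]/(\int[mu]_x csq (f x))%R.
rewrite -[fine (energy mu g)]/(\int[mu]_x csq (g x))%R -RintegralD//.
rewrite -RintegralD//.
- by apply: eq_Rintegral => x _; rewrite csqD.
- exact: (integrableD measurableT If Ig).
- exact: (integrableZl measurableT 2 iR).
Qed.

Lemma fine_energyZ (c : R[i]) f : L2 f ->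
  fine (energy mu (fun x => c * f x)) = csq c * fine (energy mu f).
Proof.
move=> Lf; rewrite energyZ ?fineM//; last by case: Lf.
exact: energy_fin_num.
Qed.

Lemma cdot_suml (s : seq nat) (c : nat -> R[i]) (u : nat -> T -> R[i]) g :
  (forall n, n \in s -> L2 (u n)) -> L2 g ->
  cdot mu (fun x => \sum_(n <- s) c n * u n x) g =
  \sum_(n <- s) c n * cdot mu (u n) g.
Proof.
move=> + Lg; elim: s => [|n s ih] Ls.
  rewrite big_nil (_ : (fun _ => _) = (fun x => 0 * (cst 0 : T -> R[i]) x)).
    by rewrite cdotZl// ?mul0r//; exact: cLfun2_0.
  by apply/funext => x; rewrite big_nil mul0r.
rewrite big_cons -ih; last by move=> m ms; apply: Ls; rewrite inE ms orbT.
rewrite -cdotZl//; last by apply: Ls; rewrite mem_head.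
rewrite -cdotDl//.
- by congr cdot; apply/funext => x; rewrite big_cons.
- by apply: cLfun2Z; apply: Ls; rewrite mem_head.
- by apply: cLfun2_sum => m ms; apply: cLfun2Z; apply: Ls; rewrite inE ms orbT.
Qed.

Lemma orthonormal_energy J u (s : seq nat) (c : nat -> R[i]) :
  orthonormal_sequence mu J u -> uniq s -> (forall n, n \in s -> J n) ->
  fine (energy mu (fun x => \sum_(n <- s) c n * u n x)) = \sum_(n <- s) csq (c n).
Proof.
move=> [Lu ou]; elim: s => [|n s ih] us sJ.
  rewrite big_nil /energy; under eq_integral do rewrite big_nil csq0.
  by rewrite integral0.
have nJ : J n by apply: sJ; rewrite mem_head.
have {}sJ m : m \in s -> J m by move=> ms; apply: sJ; rewrite inE ms orbT.
move: us => /= /andP[ns us].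
have Ls : L2 (fun x => \sum_(n <- s) c n * u n x).
  by apply: cLfun2_sum => m ms; apply: cLfun2Z; exact/Lu/sJ.
under [X in energy _ X]eq_fun do rewrite big_cons.
rewrite fine_energyD//; last by apply: cLfun2Z; exact: Lu.
rewrite big_cons fine_energyZ; last exact: Lu.
rewrite -Re_cdot_self ou// eqxx mulr1 ih// cdotZl//; last exact: Lu.
rewrite (cdotC Ls (Lu _ nJ)) cdot_suml; last exact: Lu.
  rewrite [X in conjc X]big1_seq ?conjc0 ?mulr0 /= ?mulr0 ?addr0 1?addrC//.
  move=> m /= ms.
  rewrite ou//; last exact: sJ.
  by case: eqP => [mn|_]; [move: ns; rewrite -mn ms|rewrite mulr0].
by move=> m ms; exact/Lu/sJ.
Qed.

(** Dual to the upper Riesz bound: expand the nonnegative energy of G - B k,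
    where G = sum_n conj <u_n, k> u_n. *)
Lemma bessel (B : R) (s : seq nat) (u : nat -> T -> R[i]) (k : T -> R[i]) :
  0 < B ->
  (forall n, n \in s -> L2 (u n)) ->
  (forall c : nat -> R[i], fine (energy mu (fun x => \sum_(n <- s) c n * u n x)) <=
     B * \sum_(n <- s) csq (c n)) ->
  L2 k ->
  \sum_(n <- s) csq (cdot mu (u n) k) <= B * fine (energy mu k).
Proof.
move=> B0 Lu bound Lk.
pose c n := conjc (cdot mu (u n) k).
pose G x := \sum_(n <- s) c n * u n x.
have LG : L2 G by apply: cLfun2_sum => n ns; apply: cLfun2Z; exact: Lu.
pose S := \sum_(n <- s) csq (cdot mu (u n) k).
have GS : fine (energy mu G) <= B * S.
  apply: le_trans (bound c) _; rewrite ler_pM2l//.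
  by rewrite le_eqVlt; apply/orP; left; apply/eqP/eq_bigr => n _; rewrite csq_conjc.
have Gk : complex.Re (cdot mu G k) = S.
  rewrite cdot_suml// raddf_sum; apply: eq_bigr => n _.
  by rewrite /c; case: (cdot _ _ _) => a b; rewrite /csq /=; ring.
(* B k is the point at which the quadratic expansion gives the bound B |k|^2 *)
pose b : R[i] := Complex (- B) 0.
have Lbk : L2 (fun x => b * k x) by exact: cLfun2Z.
have : 0 <= fine (energy mu (fun x => G x + b * k x)).
  by rewrite fine_ge0// energy_ge0.
rewrite fine_energyD// fine_energyZ// (cdotC Lbk LG) cdotZl// (cdotC LG Lk).
have -> : complex.Re (conjc (b * conjc (cdot mu G k))) = - B * S.
  by rewrite -Gk /b; case: (cdot _ _ _) => p q /=; ring.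
rewrite /csq /b /= -/S => h.
rewrite -(ler_pM2l B0); nra.
Qed.

End inner_product.

Section riesz.
Context d (T : measurableType d) (R : realType).
Variable mu : {measure set T -> \bar R}.
Implicit Types f g : T -> R[i].
Local Notation L2 := (cLfun mu 2%:E).

Lemma bounded_linear_energy U : bounded_linear_L2 mu U ->
  exists2 K : R, 0 < K &
    forall f, L2 f -> fine (energy mu (U f)) <= K * fine (energy mu f).
Proof.
move=> [UL _ [C UC]]; exists (C ^+ 2 + 1); first by rewrite ltr_wpDl// sqr_ge0.
move=> f Lf; have := UC _ Lf; rewrite -!cLnorm2_sqr.
have := UL _ Lf; case=> _; have := cLnorm_ge0 mu 2%:E (U f).
have := cLnorm_ge0 mu 2%:E f; case: Lf => _.
case: (cLnorm mu 2%:E f) => [r|h|//]; last by move: h; rewrite ltxx.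
case: (cLnorm mu 2%:E (U f)) => [q|_ _ _ h|//]; last by move: h; rewrite ltxx.
rewrite -!EFinM !lee_fin /= => _ r0 q0 _ qC.
have : q * q <= (C * r) * (C * r) by apply: ler_pM.
by have := sqr_ge0 r; lra.
Qed.

(** The identity is the required isomorphism, so only Riesz sequences have to be
    considered. *)
Lemma orthonormal_riesz J u : orthonormal_sequence mu J u -> riesz_sequence mu J u.
Proof.
move=> ou; split; first by case: ou.
have bid : bounded_linear_L2 mu (fun f : T -> R[i] => f).
  split=> //; first by move=> a f g _ _; exact: ae_eq_refl.
  by exists 1 => f _; rewrite mul1e.
by exists id, id; split=> // f _; split; exact: ae_eq_refl.
Qed.

(** Linearity almost everywhere passes to finite sums because a finite union of
    null sets is null. *)
Lemma linear_L2_sum V (s : seq nat) (c : nat -> R[i]) (e u : nat -> T -> R[i]) :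
  bounded_linear_L2 mu V ->
  (forall n, n \in s -> L2 (e n)) ->
  (forall n, n \in s -> V (e n) = u n %[ae mu]) ->
  V (fun x => \sum_(n <- s) c n * e n x) =
    (fun x => \sum_(n <- s) c n * u n x) %[ae mu].
Proof.
move=> [VL Vlin _]; elim: s => [|n s ih] Le Vu.
  (* V 0 = V (1 * 0 + 0) = V 0 + V 0 *)
  have := Vlin 1 _ _ (cLfun2_0 mu) (cLfun2_0 mu).
  rewrite (_ : (fun x : T => 1 * 0 + 0) = (fun x => \sum_(n <- [::]) c n * e n x)); last first.
    by apply/funext => x; rewrite big_nil mulr0 addr0.
  rewrite (_ : (fun x : T => 0) = (fun x => \sum_(n <- [::]) c n * e n x)); last first.
    by apply/funext => x; rewrite big_nil.
  apply: filterS => x /= h _; have := h I; rewrite big_nil mul1r => /eqP.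
  by rewrite -[X in X == _]addr0 (inj_eq (addrI _)) eq_sym => /eqP.
rewrite (_ : (fun x => \sum_(n <- n :: s) c n * e n x) =
  (fun x => c n * e n x + \sum_(n <- s) c n * e n x)); last first.
  by apply/funext => x; rewrite big_cons.
have sub m : m \in s -> m \in n :: s by move=> ms; rewrite inE ms orbT.
have {}ih := ih (fun m ms => Le m (sub _ ms)) (fun m ms => Vu m (sub _ ms)).
have Ls : L2 (fun x => \sum_(n <- s) c n * e n x).
  by apply: cLfun2_sum => m ms; apply: cLfun2Z; apply: Le; rewrite inE ms orbT.
have h1 := Vlin (c n) _ _ (Le _ (mem_head _ _)) Ls.
have h2 := Vu _ (mem_head _ _).
apply: filterS3 ih h1 h2 => x /= ih h1 h2 _.
by rewrite h1// big_cons ih// h2.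
Qed.

(** The sum of the c_n u_n is the image under V, the bounded inverse of U, of the
    corresponding sum of orthonormal vectors, whose energy is the sum of the
    squares of the |c_n|. *)
Lemma riesz_upper_bound J u : riesz_sequence mu J u ->
  exists2 B : R, 0 < B & forall (s : seq nat) (c : nat -> R[i]),
    uniq s -> (forall n, n \in s -> J n) ->
    fine (energy mu (fun x => \sum_(n <- s) c n * u n x)) <= B * \sum_(n <- s) csq (c n).
Proof.
move=> [Lu [U [V [bU bV UV oU]]]].
have [K K0 VK] := bounded_linear_energy bV.
exists K => // s c us sJ.
have Le n : n \in s -> L2 (U (u n)) by move=> /sJ; case: oU => + _; exact.
rewrite -(orthonormal_energy c oU us sJ).
have Ls : L2 (fun x => \sum_(n <- s) c n * U (u n) x).
  by apply: cLfun2_sum => m ms; apply: cLfun2Z; exact: Le.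
apply: le_trans (VK _ Ls).
rewrite le_eqVlt; apply/orP; left; apply/eqP; congr fine.
apply: ae_eq_energy.
- have /cLfun2_sum[] : forall n, n \in s -> L2 (fun x => c n * u n x).
    by move=> n ns; apply: cLfun2Z; exact/Lu/sJ.
  by [].
- by case: bV => + _ _ => /(_ _ Ls)[].
have := linear_L2_sum c bV Le (fun n ns => (UV _ (Lu _ (sJ _ ns))).1).
by apply: filterS => x /= h _; rewrite h.
Qed.

(** U sends u_n to a unit vector and is bounded. *)
Lemma riesz_lower_bound J u : riesz_sequence mu J u ->
  exists2 a : R, 0 < a & forall n, J n -> a <= fine (energy mu (u n)).
Proof.
move=> [Lu [U [V [bU bV UV oU]]]].
have [K K0 UK] := bounded_linear_energy bU.
exists K^-1; first by rewrite invr_gt0.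
move=> n Jn; rewrite -(ler_pM2l K0) mulfV ?gt_eqF//.
apply: le_trans (UK _ (Lu _ Jn)).
by rewrite -Re_cdot_self; case: oU => _ ->//; rewrite eqxx.
Qed.

End riesz.

(** * Completeness of the space of square integrable functions *)

Definition half_pow {R : realType} (j : nat) : R := (2 ^ j.+1)%:R^-1.

Section completeness.
Context d (T : measurableType d) (R : realType).
Variable mu : {measure set T -> \bar R}.

Lemma half_pow_gt0 j : 0 < half_pow j :> R.
Proof. by rewrite invr_gt0 ltr0n expn_gt0. Qed.

Lemma half_pow_sqr_cvg0 : half_pow j ^+ 2 @[j --> \oo] --> (0 : R).
Proof.
apply: (@squeeze_cvgr _ _ _ _ (fun=> 0) (fun j => j.+1%:R^-1)).
- apply: nearW => j; rewrite sqr_ge0/=.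
  have hj : half_pow j <= j.+1%:R^-1 :> R.
    by rewrite lef_pV2 ?posrE ?ltr0n ?expn_gt0// ler_nat ltnW// ltn_expl.
  have j1 : j.+1%:R^-1 <= 1 :> R by rewrite invf_le1// ler1n.
  by rewrite expr2 -[leRHS]mulr1 ler_pM ?(ltW (half_pow_gt0 j))// (le_trans hj).
- exact: cvg_cst.
- exact: cvg_harmonic.
Qed.

(** Trades summability of absolute values for summability of weighted squares,
    which is what an energy bound controls. *)
Lemma normr_le_eps_sqr (e a : R) : 0 < e -> `|a| <= e + e^-1 * a ^+ 2.
Proof.
move=> e0; have [ae|ea] := leP `|a| e.
  by rewrite (le_trans ae)// lerDl mulr_ge0 ?sqr_ge0// invr_ge0 ltW.
rewrite ler_wpDl ?(ltW e0)// -(real_normK (num_real a)) ler_pdivlMl// expr2.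
by rewrite ler_wpM2r// ltW.
Qed.

Lemma cvg_of_bounded_variation (a : nat -> R) (C : R) :
  (forall n, \sum_(0 <= i < n) `|a i.+1 - a i| <= C) -> cvgn a.
Proof.
move=> aC; have : cvgn (series (telescope a)).
  apply: normed_cvg; apply: nondecreasing_is_cvgn.
    by apply: nondecreasing_series => // n _ _; rewrite normr_ge0.
  by exists C => _ [n _ <-]; exact: aC.
rewrite telescopeK => h.
rewrite (_ : a = (fun n => (a n - a 0%N) + a 0%N)); last first.
  by apply/funext => n; rewrite subrK.
by apply: is_cvgD => //; exact: is_cvg_cst.
Qed.

Let hp_gt0 j : 0 < half_pow j :> R. Proof. exact: half_pow_gt0. Qed.

Let ae_cvg (u : nat -> T -> R) :
  (forall j, measurable_fun setT (u j)) ->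
  (forall j, (\int[mu]_x ((u j.+1 x - u j x) ^+ 2)%:E <= (half_pow j ^+ 2)%:E)%E) ->
  {ae mu, forall x, cvgn (u ^~ x)}.
Proof.
move=> mu_ hu.
(* the weights 2^(j+1) are compensated by the energies, at most 4^(-j-1) *)
pose f j x := ((half_pow j)^-1 * (u j.+1 x - u j x) ^+ 2)%:E.
have f0 j x : (0 <= f j x)%E.
  by rewrite lee_fin mulr_ge0 ?sqr_ge0// invr_ge0 ltW.
have mD j : measurable_fun setT (fun x => (u j.+1 x - u j x) ^+ 2).
  by apply: measurable_funX; exact: measurable_funB.
have mf j : measurable_fun setT (f j).
  by apply/measurable_EFinP; exact: measurable_funM.
have fy : (\int[mu]_x (\sum_(j <oo) f j x) < +oo)%E.
  rewrite integral_nneseries//.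
  apply: (@le_lt_trans _ _ (\sum_(j <oo) (half_pow j)%:E)%E).
    apply: lee_nneseries => [j _ _|j _]; first by apply: integral_ge0 => x _; exact: f0.
    rewrite /f; under eq_integral do rewrite EFinM.
    rewrite ge0_integralZl_EFin//; last 3 first.
    - by move=> x _; rewrite lee_fin sqr_ge0.
    - exact/measurable_EFinP.
    - by rewrite invr_ge0 ltW.
    apply: (@le_trans _ _ ((half_pow j)^-1%:E * (half_pow j ^+ 2)%:E)%E).
      by rewrite lee_pmul2l// lte_fin invr_gt0.
    by rewrite -EFinM lee_fin expr2 mulKf// gt_eqF.
  have := @cvg_geometric_eseries_half R 1 0; rewrite expr0 divr1 => h.
  rewrite (_ : (\sum_(j <oo) (half_pow j)%:E)%E = 1%E) ?ltry//.
  apply/cvg_lim => //; apply: cvg_trans h; apply: near_eq_cvg; near=> n.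
  by rewrite /eseries /=; apply: eq_bigr => j _; rewrite /half_pow addn1 div1r.
have : mu.-integrable setT (fun x => \sum_(j <oo) f j x)%E.
  apply/integrableP; split.
    by apply: ge0_emeasurable_sum => // j x _ _; exact: f0.
  under eq_integral do rewrite gee0_abs ?nneseries_ge0//.
  exact: fy.
move=> /(integrable_ae measurableT); apply: filterS => x /(_ I) sx.
apply: (@cvg_of_bounded_variation _ (1 + fine (\sum_(j <oo) f j x)%E)) => n.
rewrite -lee_fin EFinD fineK//.
apply: (@le_trans _ _ (\sum_(0 <= i < n) (half_pow i)%:E + \sum_(0 <= i < n) f i x)%E).
  rewrite !sumEFin -EFinD lee_fin -big_split/= ler_sum// => i _.
  exact: normr_le_eps_sqr.
apply: leeD; last first.
  by apply: nneseries_lim_ge => j _ _; exact: f0.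
have := @cvg_geometric_eseries_half R 1 0; rewrite expr0 divr1 => /cvg_lim <-//.
apply: le_trans (nneseries_lim_ge n _); last first.
  by move=> k _ _; rewrite lee_fin divr_ge0.
by rewrite le_eqVlt; apply/orP; left; apply/eqP/eq_bigr => j _; rewrite /half_pow addn1 div1r.
Unshelve. all: by end_near. Qed.

Lemma limn_einf_le (u : nat -> \bar R) (c : \bar R) (N : nat) :
  (forall n, (N <= n)%N -> (u n <= c)%E) -> (limn_einf u <= c)%E.
Proof.
move=> uc; rewrite limn_einf_lim; apply: lime_le; first exact: is_cvg_einfs.
near=> n; apply: (@le_trans _ _ (u n)); last by apply: uc; near: n; exact: nbhs_infty_ge.
by apply: ereal_inf_lbound; exists n => /=.
Unshelve. all: by end_near. Qed.

(** A rapidly Cauchy sequence of square integrable functions converges almost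
    everywhere, and Fatou's lemma turns this into convergence of energies. *)
Lemma energy_complete (F : nat -> T -> R[i]) :
  (forall j, cmeasurable (F j)) ->
  (forall j k, (j <= k)%N ->
     (energy mu (fun x => F j x - F k x)%R <= (half_pow j ^+ 2)%:E)%E) ->
  exists2 G, cmeasurable G &
    forall j, (energy mu (fun x => F j x - G x)%R <= (half_pow j ^+ 2)%:E)%E.
Proof.
move=> mF cF.
have aeR : {ae mu, forall x, cvgn (fun j => complex.Re (F j x))}.
  apply: (ae_cvg (u := fun j x => complex.Re (F j x))) => [j|j].
    by case: (mF j).
  apply: le_trans (cF j j.+1 (leqnSn j)); rewrite energyBC.
  apply: ge0_le_integral => //.
  - by move=> x _; rewrite lee_fin sqr_ge0.
  - apply/measurable_EFinP; apply: measurable_funX; apply: measurable_funB.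
      by case: (mF j.+1).
    by case: (mF j).
  - by apply: measurable_ecsq; exact: cmeasurableB.
  - by move=> x _; rewrite lee_fin -ReB Re_sqr_le.
have aeI : {ae mu, forall x, cvgn (fun j => complex.Im (F j x))}.
  apply: (ae_cvg (u := fun j x => complex.Im (F j x))) => [j|j].
    by case: (mF j).
  apply: le_trans (cF j j.+1 (leqnSn j)); rewrite energyBC.
  apply: ge0_le_integral => //.
  - by move=> x _; rewrite lee_fin sqr_ge0.
  - apply/measurable_EFinP; apply: measurable_funX; apply: measurable_funB.
      by case: (mF j.+1).
    by case: (mF j).
  - by apply: measurable_ecsq; exact: cmeasurableB.
  - by move=> x _; rewrite lee_fin -ImB Im_sqr_le.
(* upper limits are measurable, and agree with the limits where these exist *)
pose G x := Complex (fine (limn_esup (fun j => (complex.Re (F j x))%:E)))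
                    (fine (limn_esup (fun j => (complex.Im (F j x))%:E))).
have mG : cmeasurable G.
  split; apply: measurableT_comp => //.
  - by apply: measurable_fun_limn_esup => j; apply/measurable_EFinP; case: (mF j).
  - by apply: measurable_fun_limn_esup => j; apply/measurable_EFinP; case: (mF j).
exists G => // j.
have mFF k : measurable_fun setT (fun x => (csq (F j x - F k x))%:E).
  by apply: measurable_ecsq; exact: cmeasurableB.
have -> : energy mu (fun x => F j x - G x)%R =
  (\int[mu]_x limn_einf (fun k => (csq (F j x - F k x))%:E))%E.
  apply: ge0_ae_eq_integral => //.
  - by apply: measurable_ecsq; exact: cmeasurableB.
  - rewrite (_ : (fun _ => _) = (fun x =>
        - limn_esup (fun k => - (csq (F j x - F k x))%:E))%E).
      apply: measurableT_comp => //; apply: measurable_fun_limn_esup => k.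
      exact: measurableT_comp.
    apply/funext => x; rewrite -limn_einfN; congr limn_einf.
    by apply/funext => k /=; rewrite ?oppeK ?opprK.
  - by move=> x _; rewrite lee_fin csq_ge0.
  - move=> x _; rewrite limn_einf_lim; apply: lime_ge; first exact: is_cvg_einfs.
    apply: nearW => n; apply: le_ereal_inf_tmp => _ [m _ <-].
    by rewrite lee_fin csq_ge0.
  apply: filterS2 aeR aeI => x cR cI _.
  have GR : complex.Re (G x) = limn (fun k => complex.Re (F k x)).
    by rewrite /= is_cvg_limn_esupE; [rewrite EFin_lim|exact: cvgP (cvg_EFin_real cR)].
  have GI : complex.Im (G x) = limn (fun k => complex.Im (F k x)).
    by rewrite /= is_cvg_limn_esupE; [rewrite EFin_lim|exact: cvgP (cvg_EFin_real cI)].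
  have h : (fun k => csq (F j x - F k x)) @ \oo --> csq (F j x - G x).
    rewrite /csq ReB ImB GR GI; under eq_fun do rewrite ReB ImB.
    by apply: cvgD; apply: cvgM; apply: cvgB => //; exact: cvg_cst.
  have h2 : (fun k => (csq (F j x - F k x))%:E) @ \oo --> (csq (F j x - G x))%:E.
    exact: cvg_EFin_real.
  by rewrite is_cvg_limn_einfE; [apply/esym/cvg_lim|exact: cvgP h2].
apply: le_trans (fatou _ _ _ _) _ => //.
- by move=> k x _; rewrite lee_fin csq_ge0.
- by apply: (@limn_einf_le _ _ j) => k jk; exact: cF.
Qed.

End completeness.

(** * The Poisson kernel as a Fourier integral *)

Section poisson.
Context {R : realType}.
Local Notation leb := (@lebesgue_measure R).

(** The multiplier of Abel summation for Fourier integrals. *)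
Definition abel_weight (a t : R) : R := expR (- (a * `|t|)).

(** The Fourier transform of [abel_weight a]. *)
Definition poisson_kernel (a t : R) : R := 2 * a / (a ^+ 2 + (2 * pi * t) ^+ 2).

Let primitive (a b x : R) : R :=
  - (a^-1 * expR (- (a * x))) +
  expR (- (a * x)) * (b * sin (b * x) - a * cos (b * x)) * (a ^+ 2 + b ^+ 2)^-1.

Let primitive_derive (a b x : R) : a != 0 ->
  is_derive x 1 (primitive a b) (expR (- (a * x)) * (1 + cos (b * x))).
Proof.
move=> a0; rewrite /primitive.
have ab : a ^+ 2 + b ^+ 2 != 0.
  by rewrite gt_eqF// ltr_pwDl ?sqr_ge0// exprn_even_gt0.
apply: is_derive_eq.
rewrite !scaler0 /GRing.scale /=.
by field; rewrite ab a0.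
Qed.

Let exp_decay (a : R) : 0 < a -> expR (- (a * x)) @[x --> +oo] --> (0 : R).
Proof.
move=> a0; have h : a * x @[x --> +oo] --> +oo by apply: gt0_cvgMry => //; exact: cvg_id.
exact: (cvg_comp _ _ h (@cvgr_expR R)).
Qed.

Let primitive_cvg (a b : R) : 0 < a -> primitive a b x @[x --> +oo] --> (0 : R).
Proof.
move=> a0; apply: norm_cvg0.
pose C := a^-1 + (`|b| + a) * (a ^+ 2 + b ^+ 2)^-1.
have ab : 0 <= (a ^+ 2 + b ^+ 2)^-1 by rewrite invr_ge0 addr_ge0// sqr_ge0.
apply: (@squeeze_cvgr _ _ _ _ (fun=> 0) (fun x => C * expR (- (a * x)))).
- apply: nearW => x; rewrite normr_ge0/=.
  rewrite /primitive (le_trans (ler_normD _ _))// /C mulrDl normrN lerD//.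
    by rewrite normrM !gtr0_norm ?expR_gt0// invr_gt0.
  rewrite !normrM (gtr0_norm (expR_gt0 _)) (ger0_norm ab).
  rewrite (mulrC (expR _)) mulrAC ler_wpM2r ?expR_ge0// ler_wpM2r//.
  rewrite (le_trans (ler_normB _ _))// lerD// normrM.
    by rewrite ler_piMr// sin_max.
  by rewrite (gtr0_norm a0) ler_piMr ?(ltW a0)// cos_max.
- exact: cvg_cst.
- rewrite -[X in _ --> X](mulr0 C); apply: cvgM; first exact: cvg_cst.
  exact: exp_decay.
Qed.

(** Adding 1 to the cosine makes the integrand nonnegative, so that the
    fundamental theorem of calculus on a half line applies. *)
Lemma abel_half_line (a b : R) : 0 < a ->
  (\int[leb]_(x in `[0%R, +oo[) (expR (- (a * x)) * (1 + cos (b * x)))%:E =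
   (a^-1 + a / (a ^+ 2 + b ^+ 2))%:E)%E.
Proof.
move=> a0; have a0' : a != 0 by rewrite gt_eqF.
have cf : continuous (fun x => expR (- (a * x)) * (1 + cos (b * x)) : R).
  move=> x; apply: cvgM.
    apply: continuous_comp; last exact: continuous_expR.
    by apply: cvgN; apply: cvgM => //; exact: cvg_cst.
  apply: cvgD; first exact: cvg_cst.
  apply: continuous_comp; last exact: continuous_cos.
  by apply: cvgM => //; exact: cvg_cst.
rewrite (@ge0_continuous_FTC2y _ _ (primitive a b) _ 0).
- rewrite -EFinB sub0r /primitive !mulr0 oppr0 expR0 sin0 cos0; congr EFin.
  by field; rewrite a0' gt_eqF// ltr_pwDl ?sqr_ge0// exprn_even_gt0.
- by move=> x _; rewrite mulr_ge0 ?expR_ge0// -lerBlDl sub0r cos_geN1.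
- exact: continuous_subspaceT.
- exact: primitive_cvg.
- by move=> x _; have [] := @primitive_derive a b x a0'.
- apply: cvg_at_right_filter.
  have dp := @primitive_derive a b 0 a0'.
  by apply: differentiable_continuous; apply/derivable1_diffP.
- move=> x _; have dp := @primitive_derive a b x a0'.
  by rewrite derive1E derive_val.
Qed.

Lemma abel_weight_ge0 a t : 0 <= abel_weight a t.
Proof. exact: expR_ge0. Qed.

Lemma continuous_abel_weight a : continuous (abel_weight a).
Proof.
move=> x; apply: continuous_comp; last exact: continuous_expR.
apply: cvgN; apply: cvgM; first exact: cvg_cst.
exact: norm_continuous.
Qed.

Lemma measurable_abel_weight a : measurable_fun setT (abel_weight a).
Proof. by apply: continuous_measurable_fun; exact: continuous_abel_weight. Qed.

Let abel_full (a b : R) : 0 < a ->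
  (\int[leb]_x (abel_weight a x * (1 + cos (b * x)))%:E =
   (2 * (a^-1 + a / (a ^+ 2 + b ^+ 2)))%:E)%E.
Proof.
move=> a0; rewrite ge0_symfun_integralT.
- rewrite EFinM -(abel_half_line b a0) -set_itvcy; congr (_ * _)%E.
  apply: eq_integral => x; rewrite inE/= in_itv/= andbT => x0.
  by rewrite /abel_weight ger0_norm.
- by move=> x; rewrite mulr_ge0 ?abel_weight_ge0// -lerBlDl sub0r cos_geN1.
- move=> x; apply: cvgM; first exact: continuous_abel_weight.
  apply: cvgD; first exact: cvg_cst.
  apply: continuous_comp; last exact: continuous_cos.
  by apply: cvgM => //; exact: cvg_cst.
- by move=> x /=; rewrite /abel_weight normrN mulrN cosN.
Qed.

Lemma integral_abel_weight (a : R) : 0 < a ->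
  (\int[leb]_x (abel_weight a x)%:E = (2 / a)%:E)%E.
Proof.
move=> a0; have := abel_full 0 a0.
under eq_integral do rewrite mul0r cos0 mulrC EFinM.
rewrite ge0_integralZl_EFin//; last 2 first.
- by move=> x _; rewrite lee_fin abel_weight_ge0.
- by apply/measurable_EFinP; exact: measurable_abel_weight.
move=> h; rewrite -[LHS]mul1e -(mulVf (x := (1 + 1 : R))); last first.
  by rewrite gt_eqF// addr_gt0.
rewrite EFinM -muleA h -EFinM; congr EFin.
by field; rewrite gt_eqF.
Qed.

Lemma integrable_abel_weight (a : R) : 0 < a ->
  leb.-integrable setT (EFin \o abel_weight a).
Proof.
move=> a0; apply/integrableP; split.
  by apply/measurable_EFinP; exact: measurable_abel_weight.
under eq_integral do rewrite /= ger0_norm ?abel_weight_ge0//.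
by rewrite integral_abel_weight// ltry.
Qed.

Lemma integrable_abel_weightM (a : R) (f : R -> R) : 0 < a ->
  measurable_fun setT f -> (forall x, `|f x| <= 1) ->
  leb.-integrable setT (EFin \o (fun x => abel_weight a x * f x)).
Proof.
move=> a0 mf f1; apply: (le_integrable measurableT _ _ (integrable_abel_weight a0)).
  by apply/measurable_EFinP; apply: measurable_funM => //; exact: measurable_abel_weight.
by move=> x _ /=; rewrite lee_fin normrM ler_piMr.
Qed.

Lemma measurable_cosM (b : R) : measurable_fun setT (fun x : R => cos (b * x)).
Proof.
apply: continuous_measurable_fun => x.
apply: continuous_comp; last exact: continuous_cos.
by apply: cvgM => //; exact: cvg_cst.
Qed.

Lemma measurable_sinM (b : R) : measurable_fun setT (fun x : R => sin (b * x)).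
Proof.
apply: continuous_measurable_fun => x.
apply: continuous_comp; last exact: continuous_sin.
by apply: cvgM => //; exact: cvg_cst.
Qed.

Lemma Rintegral_abel_cos (a b : R) : 0 < a ->
  (\int[leb]_x (abel_weight a x * cos (b * x)) = 2 * a / (a ^+ 2 + b ^+ 2)).
Proof.
move=> a0; have := abel_full b a0 => /(congr1 fine) /=.
under eq_integral do rewrite mulrDr mulr1.
rewrite -[fine _]/(\int[leb]_x (abel_weight a x + abel_weight a x * cos (b * x)))%R.
rewrite RintegralD//; last 2 first.
- exact: integrable_abel_weight.
- by apply: integrable_abel_weightM => //; [exact: measurable_cosM|move=> x; exact: cos_max].
rewrite {1}/Rintegral integral_abel_weight//=.
set S := \int[leb]_x (abel_weight a x * cos (b * x)) => h.
have -> : S = 2 * (a^-1 + a / (a ^+ 2 + b ^+ 2)) - 2 / a by rewrite -h addrC addKr.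
have a0' : a != 0 by rewrite gt_eqF.
have ab : a ^+ 2 + b ^+ 2 != 0.
  by rewrite gt_eqF// ltr_pwDl ?sqr_ge0// exprn_even_gt0.
by field; rewrite ?ab ?a0'.
Qed.

(** The reflected translation y |-> x - y preserves the length of intervals,
    hence Lebesgue measure. *)
Lemma ge0_integral_subl (x : R) (f : R -> \bar R) :
  measurable_fun setT f -> (forall y, 0 <= f y)%E ->
  (\int[leb]_y f (x - y)%R = \int[leb]_y f y)%E.
Proof.
move=> mf f0.
pose phi : measurableTypeR R -> measurableTypeR R := fun y : R => x - y.
have mphi : measurable_fun setT phi.
  by apply: measurable_funB => //; exact: measurable_cst.
transitivity (\int[pushforward leb phi]_y f y)%E.
  by rewrite ge0_integral_pushforward// preimage_setT.
apply: eq_measure_integral => A mA _; apply/esym/lebesgue_measure_unique => //.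
move=> _ [[a b]] _ <- /=; rewrite /pushforward.
rewrite (_ : phi @^-1` _ = `[(x - b)%R, (x - a)%R[%classic); last first.
  apply/seteqP; split => y; rewrite /phi /= !in_itv/=; move=> /andP[h1 h2]; apply/andP; split; lra.
by rewrite !lebesgue_measure_itv/= !lte_fin ltrD2l ltrN2; case: ifP => // _; rewrite -!EFinD; congr EFin; ring.
Qed.

(** The integral is invariant under omega |-> - omega and the integrand is odd. *)
Lemma Rintegral_abel_sin (a b : R) : 0 < a ->
  (\int[leb]_x (abel_weight a x * sin (b * x)) = 0).
Proof.
move=> a0.
have iS : leb.-integrable setT (EFin \o (fun x => abel_weight a x * sin (b * x))).
  by apply: integrable_abel_weightM => //; [exact: measurable_sinM|move=> x; exact: sin_max].
have iw := integrable_abel_weight a0.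
have h : \int[leb]_x (abel_weight a x - abel_weight a x * sin (b * x)) =
         \int[leb]_x (abel_weight a x + abel_weight a x * sin (b * x)).
  congr fine; rewrite -[RHS](@ge0_integral_subl 0).
  - apply: eq_integral => x _.
    by rewrite sub0r /abel_weight normrN mulrN sinN mulrN.
  - apply/measurable_EFinP; apply: measurable_funD; first exact: measurable_abel_weight.
    by apply: measurable_funM; [exact: measurable_abel_weight|exact: measurable_sinM].
  - move=> x; have : 0 <= abel_weight a x * (1 + sin (b * x)).
      by rewrite mulr_ge0 ?abel_weight_ge0// -lerBlDl sub0r sin_geN1.
    by rewrite lee_fin mulrDr mulr1.
move: h; rewrite RintegralB// RintegralD//.
by set S := \int[leb]_x (abel_weight a x * sin (b * x)); lra.
Qed.

Lemma poisson_kernel_ge0 a t : 0 < a -> 0 <= poisson_kernel a t.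
Proof.
by move=> a0; rewrite divr_ge0 ?mulr_ge0 ?addr_ge0 ?sqr_ge0 ?(ltW a0).
Qed.

Lemma poisson_kernelN a t : poisson_kernel a (- t) = poisson_kernel a t.
Proof. by rewrite /poisson_kernel mulrN sqrrN. Qed.

Lemma continuous_poisson_kernel a : 0 < a -> continuous (poisson_kernel a).
Proof.
move=> a0 t; apply: cvgM; first exact: cvg_cst.
apply: cvgV; first by rewrite gt_eqF// ltr_pwDl ?sqr_ge0// exprn_even_gt0 ?gt_eqF.
apply: cvgD; first exact: cvg_cst.
by apply: cvgM; apply: cvgM => //; exact: cvg_cst.
Qed.

Lemma measurable_poisson_kernel a : 0 < a -> measurable_fun setT (poisson_kernel a).
Proof. by move=> a0; apply: continuous_measurable_fun; exact: continuous_poisson_kernel. Qed.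

(** The arctangent is an antiderivative, and it tends to pi / 2. *)
Lemma integral_poisson_kernel a : 0 < a ->
  (\int[leb]_t (poisson_kernel a t)%:E = 1)%E.
Proof.
move=> a0; have a0' : a != 0 by rewrite gt_eqF.
have pi0 : (pi : R) != 0 by rewrite gt_eqF// pi_gt0.
rewrite ge0_symfun_integralT; last 3 first.
- by move=> t; exact: poisson_kernel_ge0.
- exact: continuous_poisson_kernel.
- by move=> t /=; rewrite poisson_kernelN.
rewrite -set_itvcy.
pose F (t : R) := pi^-1 * atan (2 * pi / a * t).
have dF (x : R) : is_derive x 1 F (poisson_kernel a x).
  apply: is_derive_eq; rewrite /GRing.scale /= /poisson_kernel.
  have : a ^+ 2 + (2 * pi * x) ^+ 2 != 0.
    by rewrite gt_eqF// ltr_pwDl ?sqr_ge0// exprn_even_gt0.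
  have : 1 + (2 * pi / a * x) ^+ 2 != 0 by rewrite gt_eqF// ltr_pwDl ?sqr_ge0.
  move: pi0; move: (@pi R) => p p0 h1 h2.
  by field; rewrite ?a0' ?p0 ?h1 ?h2.
rewrite (@ge0_continuous_FTC2y _ _ F _ 2^-1).
- by rewrite /F mulr0 atan0 mulr0 sube0 -EFinM mulfV.
- by move=> x _; exact: poisson_kernel_ge0.
- by apply: continuous_subspaceT; exact: continuous_poisson_kernel.
- rewrite (_ : 2^-1 = pi^-1 * (pi / 2)); last by rewrite mulKf.
  apply: cvgM; first exact: cvg_cst.
  have h : 2 * pi / a * x @[x --> +oo] --> +oo.
    by apply: gt0_cvgMry; [rewrite divr_gt0// mulr_gt0// pi_gt0|exact: cvg_id].
  exact: (cvg_comp _ _ h (@cvgy_atan R)).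
- by move=> x _; have [] := dF x.
- apply: cvg_at_right_filter; have := dF 0 => ?.
  by apply: differentiable_continuous; apply/derivable1_diffP.
- by move=> x _; have ? := dF x; rewrite derive1E derive_val.
Qed.

Lemma integral_poisson_kernel_subl a x : 0 < a ->
  (\int[leb]_y (poisson_kernel a (x - y))%:E = 1)%E.
Proof.
move=> a0; rewrite -(integral_poisson_kernel a0).
apply: (@ge0_integral_subl x (fun t => (poisson_kernel a t)%:E)).
  by apply/measurable_EFinP; exact: measurable_poisson_kernel.
by move=> y; rewrite lee_fin poisson_kernel_ge0.
Qed.

End poisson.

(** * Frequency energy as a Poisson average *)

Section product_integrals.
Context d1 d2 (T1 : measurableType d1) (T2 : measurableType d2) (R : realType).
Variables (m1 : {sigma_finite_measure set T1 -> \bar R})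
          (m2 : {sigma_finite_measure set T2 -> \bar R}).
Local Open Scope ereal_scope.

(** The product measure under its own name, so that it carries a sigma-finite
    structure and can serve as a factor of another product. *)
Definition prod_measure : set (T1 * T2) -> \bar R := (m1 \x m2)%E.
HB.instance Definition _ := Measure.on prod_measure.

Lemma sigma_finite_prod_measure : sigma_finite setT prod_measure.
Proof.
have [F [FT Fnd mF]] := (sigma_finiteP _ m1).1 (sigma_finiteT m1).
have [G [GT Gnd mG]] := (sigma_finiteP _ m2).1 (sigma_finiteT m2).
exists (fun i => F i `*` G i).
  apply/seteqP; split => // -[x y] _.
  have : [set: T1] x by []. have : [set: T2] y by [].
  rewrite FT GT => -[j _ Gy] [i _ Fx]; exists (maxn i j) => //; split => /=.
    by have /subsetPset := Fnd _ _ (leq_maxl i j); exact.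
  by have /subsetPset := Gnd _ _ (leq_maxr i j); exact.
move=> i; have [[mFi Fi] [mGi Gi]] := (mF i, mG i).
split; first exact: measurableX.
by rewrite /prod_measure product_measure1E// lte_mul_pinfty// ge0_fin_numE.
Qed.
HB.instance Definition _ := Measure_isSigmaFinite.Build _ _ _ prod_measure sigma_finite_prod_measure.

Lemma measurable_fst_comp d (U : measurableType d) (f : T1 -> U) :
  measurable_fun setT f -> measurable_fun setT (fun z : T1 * T2 => f z.1).
Proof. by move=> mf; apply: (measurableT_comp mf); exact: measurable_fst. Qed.

Lemma measurable_snd_comp d (U : measurableType d) (f : T2 -> U) :
  measurable_fun setT f -> measurable_fun setT (fun z : T1 * T2 => f z.2).
Proof. by move=> mf; apply: (measurableT_comp mf); exact: measurable_snd. Qed.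

Lemma cmeasurable_fst_comp (f : T1 -> R[i]) :
  cmeasurable f -> cmeasurable (fun z : T1 * T2 => f z.1).
Proof.
move=> [fR fI]; split.
  exact: (@measurable_fst_comp _ _ (fun x => complex.Re (f x)) fR).
exact: (@measurable_fst_comp _ _ (fun x => complex.Im (f x)) fI).
Qed.

Lemma cmeasurable_snd_comp (f : T2 -> R[i]) :
  cmeasurable f -> cmeasurable (fun z : T1 * T2 => f z.2).
Proof.
move=> [fR fI]; split.
  exact: (@measurable_snd_comp _ _ (fun x => complex.Re (f x)) fR).
exact: (@measurable_snd_comp _ _ (fun x => complex.Im (f x)) fI).
Qed.

(** Tonelli applies to the positive and to the negative part, whereas Fubini
    asks for integrability on the product, which fails for Fourier kernels. *)
Lemma measurable_integral_section (f : T1 * T2 -> R) : measurable_fun setT f ->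
  measurable_fun setT (fun x => \int[m2]_y (f (x, y)))%R.
Proof.
move=> mf; apply: measurableT_comp => //.
have mEf : measurable_fun setT (EFin \o f) by exact/measurable_EFinP.
rewrite (_ : (fun x => _) = fun x => fubini_F m2 (EFin \o f)^\+ x - fubini_F m2 (EFin \o f)^\- x).
  apply: emeasurable_funB.
    by apply: measurable_fun_fubini_tonelli_F => //; exact: measurable_funepos.
  by apply: measurable_fun_fubini_tonelli_F => //; exact: measurable_funeneg.
apply/funext => x; rewrite integralE; congr (_ - _); apply: eq_integral => y _.
  by rewrite !funeposE.
by rewrite !funenegE.
Qed.

Variables (f : T1 -> R) (g : T2 -> R).
Hypotheses (If : m1.-integrable setT (EFin \o f))
           (Ig : m2.-integrable setT (EFin \o g)).

Lemma integrable_tensor :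
  (m1 \x m2).-integrable setT (EFin \o (fun z => f z.1 * g z.2)%R).
Proof.
have mf : measurable_fun setT f by apply/measurable_EFinP; exact: measurable_int If.
have mg : measurable_fun setT g by apply/measurable_EFinP; exact: measurable_int Ig.
have mfg : measurable_fun setT (EFin \o (fun z : T1 * T2 => f z.1 * g z.2)%R).
  apply/measurable_EFinP; apply: measurable_funM.
    exact: measurable_fst_comp.
  exact: measurable_snd_comp.
apply/(integrable12ltyP m1 m2 mfg).
have -> : \int[m1]_x \int[m2]_y `|(EFin \o (fun z => f z.1 * g z.2)%R) (x, y)|
    = \int[m1]_x (`|(f x)%:E| * \int[m2]_y `|(g y)%:E|).
  apply: eq_integral => x _; rewrite -ge0_integralZl//.
    by apply: eq_integral => y _ /=; rewrite normrM EFinM.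
  by apply: measurableT_comp => //; exact/measurable_EFinP.
rewrite ge0_integralZr//.
- by apply: lte_mul_pinfty; [exact: integral_ge0|
    rewrite ge0_fin_numE ?integral_ge0//; case/integrableP: If|case/integrableP: Ig].
- by apply: measurableT_comp => //; exact/measurable_EFinP.
- exact: integral_ge0.
Qed.

Lemma Rintegral_tensor :
  (\int[m1 \x m2]_z (f z.1 * g z.2) = \int[m1]_x f x * \int[m2]_y g y)%R.
Proof.
rewrite {1}/Rintegral -(integral12_prod_meas1 integrable_tensor).
have -> : \int[m1]_x fubini_F m2 (EFin \o (fun z => f z.1 * g z.2)%R) x
    = \int[m1]_x (f x * \int[m2]_y g y)%:E.
  apply: eq_integral => x _; rewrite /fubini_F /= EFinM /Rintegral fineK.
    by rewrite -integralZl//.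
  exact: integrable_fin_num.
by rewrite -[fine _]/(\int[m1]_x (f x * \int[m2]_y g y))%R RintegralZr.
Qed.

End product_integrals.

Section abel_energy.
Context {R : realType}.
Local Notation leb := (@lebesgue_measure R).
Local Notation leb2 := (prod_measure leb leb).
Implicit Types h : measurableTypeR R -> R[i].

Lemma normr_Re_conjcM_le (z w : R[i]) : `|complex.Re (z * conjc w)| <= cmod z * cmod w.
Proof.
rewrite -(@ler_pXn2r _ 2) ?nnegrE ?mulr_ge0 ?cmod_ge0// exprMn !sqr_cmod.
by rewrite real_normK ?num_real// -(csq_conjc w) -csqM Re_sqr_le.
Qed.

Lemma normr_Im_conjcM_le (z w : R[i]) : `|complex.Im (z * conjc w)| <= cmod z * cmod w.
Proof.
rewrite -(@ler_pXn2r _ 2) ?nnegrE ?mulr_ge0 ?cmod_ge0// exprMn !sqr_cmod.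
by rewrite real_normK ?num_real// -(csq_conjc w) -csqM Im_sqr_le.
Qed.

Lemma measurable_cmod d (T : measurableType d) (f : T -> R[i]) :
  cmeasurable f -> measurable_fun setT (fun x => cmod (f x)).
Proof.
move=> mf; rewrite (_ : (fun _ => _) = (fun x => Num.sqrt (csq (f x)))).
  apply: measurableT_comp; last exact: measurable_csq.
  by apply: continuous_measurable_fun; exact: sqrt_continuous.
by apply/funext => x; rewrite -sqr_cmod sqrtr_sqr ger0_norm ?cmod_ge0.
Qed.

Lemma integrable_cmod h : cLfun leb 1%:E h ->
  leb.-integrable setT (EFin \o (fun x => cmod (h x))).
Proof.
move=> [mh hy]; apply/integrableP; split.
  by apply/measurable_EFinP; exact: measurable_cmod.
under eq_integral do rewrite /= ger0_norm ?cmod_ge0//.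
by rewrite -cLnorm1E.
Qed.

Let phase (omega x : R) : R := - (2 * pi * omega * x).

Lemma cmeasurable_cexpi d (T : measurableType d) (f : T -> R) :
  measurable_fun setT f -> cmeasurable (fun x => cexpi (f x)).
Proof.
move=> mf; split => /=; apply: measurableT_comp => //.
  by apply: continuous_measurable_fun; exact: continuous_cos.
by apply: continuous_measurable_fun; exact: continuous_sin.
Qed.

Lemma measurable_phase (omega : R) :
  measurable_fun setT (fun x : measurableTypeR R => - (2 * pi * omega * x)).
Proof. by apply: measurable_funN; exact: measurable_funM. Qed.

Lemma integrable_fourier h omega : cLfun leb 1%:E h ->
  leb.-integrable setT (EFin \o (fun x => complex.Re (h x * cexpi (phase omega x)))) /\
  leb.-integrable setT (EFin \o (fun x => complex.Im (h x * cexpi (phase omega x)))).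
Proof.
move=> Lh; have [mh _] := Lh.
have [mR mI] := cmeasurableM mh (cmeasurable_cexpi (measurable_phase omega)).
split; apply: (le_integrable measurableT _ _ (integrable_cmod Lh)) => //=; try exact/measurable_EFinP.
- move=> x _; rewrite lee_fin (ger0_norm (cmod_ge0 _)) (le_trans (normr_Re_le _))//.
  by rewrite -(@ler_pXn2r _ 2) ?nnegrE ?cmod_ge0// !sqr_cmod csqM csq_cexpi mulr1.
- move=> x _; rewrite lee_fin (ger0_norm (cmod_ge0 _)) (le_trans (normr_Im_le _))//.
  by rewrite -(@ler_pXn2r _ 2) ?nnegrE ?cmod_ge0// !sqr_cmod csqM csq_cexpi mulr1.
Qed.

Lemma cmeasurable_fourier_integral h : cmeasurable h ->
  cmeasurable (fourier_integral h).
Proof.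
move=> mh.
have m2 : cmeasurable (fun z : measurableTypeR R * measurableTypeR R =>
    h z.2 * cexpi (- (2 * pi * z.1 * z.2))).
  apply: cmeasurableM.
    exact: (@cmeasurable_snd_comp _ _ (measurableTypeR R) (measurableTypeR R) R h mh).
  apply: cmeasurable_cexpi; apply: measurable_funN.
  by apply: measurable_funM => //; apply: measurable_funM.
case: m2 => mR mI; split.
  exact: (measurable_integral_section leb mR).
exact: (measurable_integral_section leb mI).
Qed.

(** The real part of h (x) conj (h (y)) e^(-2 pi i omega (x - y)). *)
Let kernel h (omega : R) (z : measurableTypeR R * measurableTypeR R) : R :=
  complex.Re (h z.1 * conjc (h z.2)) * cos (2 * pi * (z.1 - z.2) * omega) +
  complex.Im (h z.1 * conjc (h z.2)) * sin (2 * pi * (z.1 - z.2) * omega).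

Let csq_fourier_integral h omega : cLfun leb 1%:E h ->
  csq (fourier_integral h omega) = \int[(leb \x leb)%E]_z kernel h omega z.
Proof.
move=> Lh; have [IR II] := integrable_fourier omega Lh.
rewrite /csq /fourier_integral /cintegral [complex.Re (Complex _ _)]/= [complex.Im (Complex _ _)]/=.
rewrite !expr2 -(Rintegral_tensor IR IR) -(Rintegral_tensor II II).
rewrite -RintegralD//; last 2 first.
- exact: (integrable_tensor IR IR).
- exact: (integrable_tensor II II).
apply: eq_Rintegral => -[x y] _; rewrite /kernel /=.
rewrite (_ : 2 * pi * (x - y) * omega = 2 * pi * omega * x - 2 * pi * omega * y); last by ring.
rewrite cosB sinB /phase; case: (h x) (h y) => [a b] [c e] /=.
rewrite !cosN !sinN.
set cx := cos _; set cy := cos (2 * pi * omega * y).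
set sx := sin _; set sy := sin (2 * pi * omega * y).
by ring.
Qed.

Let measurable_kernel h d (T : measurableType d) (w : T -> R)
    (x y : T -> measurableTypeR R) :
  cmeasurable h -> measurable_fun setT w -> measurable_fun setT x ->
  measurable_fun setT y -> measurable_fun setT (fun t => kernel h (w t) (x t, y t)).
Proof.
move=> [hR hI] mw mx my.
have m1 : cmeasurable (fun t => h (x t)).
  by split; [exact: (measurableT_comp hR mx)|exact: (measurableT_comp hI mx)].
have m2 : cmeasurable (fun t => h (y t)).
  by split; [exact: (measurableT_comp hR my)|exact: (measurableT_comp hI my)].
have [mR mI] := cmeasurableM m1 (cmeasurable_conjc m2).
have mph : measurable_fun setT (fun t => 2 * pi * (x t - y t) * w t).
  apply: measurable_funM => //; apply: measurable_funM => //.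
  exact: measurable_funB.
have [mc ms] := cmeasurable_cexpi mph.
by apply: measurable_funD; exact: measurable_funM.
Qed.

(** The weight makes the integrand of the triple integral absolutely
    integrable, with majorant 2 exp (- a |omega|) |h (x)| |h (y)|. *)
Let integrable_kernel h (a : R) : 0 < a -> cLfun leb 1%:E h ->
  (leb \x leb2)%E.-integrable setT
    (EFin \o (fun t => abel_weight a t.1 * kernel h t.1 t.2)).
Proof.
move=> a0 Lh; have [mh _] := Lh.
have In := integrable_cmod Lh.
have I2 : leb2.-integrable setT
    (EFin \o (fun z => cmod (h z.1) * cmod (h z.2))) by exact: (integrable_tensor In In).
have Ib : (leb \x leb2)%E.-integrable setT
    (EFin \o (fun t => abel_weight a t.1 * (cmod (h t.2.1) * cmod (h t.2.2)))).
  exact: (@integrable_tensor _ _ (measurableTypeR R)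
    (measurableTypeR R * measurableTypeR R)%type R _ _ (abel_weight a)
    (fun z => cmod (h z.1) * cmod (h z.2)) (integrable_abel_weight a0) I2).
apply: (le_integrable measurableT _ _ (integrableZl measurableT 2 Ib)).
  apply/measurable_EFinP; apply: measurable_funM.
    by apply: measurable_fst_comp; exact: measurable_abel_weight.
  rewrite (_ : (fun t => _) = (fun t => kernel h t.1 (t.2.1, t.2.2))); last first.
    by apply/funext => -[w [x y]].
  apply: measurable_kernel => //.
    by apply: measurable_snd_comp; exact: measurable_fst.
  by apply: measurable_snd_comp; exact: measurable_snd.
move=> [w [x y]] _ /=; rewrite lee_fin !normrM !(ger0_norm (cmod_ge0 _)) (ger0_norm (abel_weight_ge0 _ _)).
rewrite mulrCA ler_wpM2l ?abel_weight_ge0// (ger0_norm (ler0n _ _)) mulr_natl mulr2n.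
rewrite (le_trans (ler_normD _ _))// !normrM lerD//.
  rewrite -[leRHS]mulr1 ler_pM//; first exact: normr_Re_conjcM_le.
  exact: cos_max.
rewrite -[leRHS]mulr1 ler_pM//; first exact: normr_Im_conjcM_le.
exact: sin_max.
Qed.

Let integrable_kernel_slice h w : cLfun leb 1%:E h ->
  (leb \x leb)%E.-integrable setT (EFin \o kernel h w).
Proof.
move=> Lh; have [mh _] := Lh.
have In := integrable_cmod Lh.
apply: (le_integrable measurableT _ _ (integrableZl measurableT 2 (integrable_tensor In In))).
  apply/measurable_EFinP.
  rewrite (_ : kernel h w = (fun z => kernel h w (z.1, z.2))); last first.
    by apply/funext => -[x y].
  by apply: measurable_kernel.
move=> [x y] _ /=; rewrite lee_fin !normrM !(ger0_norm (cmod_ge0 _)).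
rewrite (ger0_norm (ler0n _ _)) mulr_natl mulr2n.
rewrite (le_trans (ler_normD _ _))// !normrM lerD//.
  rewrite -[leRHS]mulr1 ler_pM//; first exact: normr_Re_conjcM_le.
  exact: cos_max.
rewrite -[leRHS]mulr1 ler_pM//; first exact: normr_Im_conjcM_le.
exact: sin_max.
Qed.

(** Fubini in three variables: the square of the Fourier integral at omega is a
    double integral in x and y, and the frequency integral performed first is
    the Fourier transform of the weight, at x - y; the sine part vanishes by
    parity. *)
Lemma abel_energyE h (a : R) : 0 < a -> cLfun leb 1%:E h ->
  (\int[leb]_w (abel_weight a w * csq (fourier_integral h w))%:E =
   \int[leb \x leb]_z
     (complex.Re (h z.1 * conjc (h z.2)) * poisson_kernel a (z.1 - z.2))%:E)%E.
Proof.
move=> a0 Lh; have [mh _] := Lh.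
transitivity (\int[leb]_w \int[leb2]_z (abel_weight a w * kernel h w z)%:E)%E.
  apply: eq_integral => w _; rewrite csq_fourier_integral//.
  under eq_integral do rewrite EFinM.
  have Ik := integrable_kernel_slice w Lh.
  by rewrite (integralZl measurableT Ik) EFinM /Rintegral fineK// integrable_fin_num.
rewrite (Fubini (integrable_kernel a0 Lh)); apply: eq_integral => -[x y] _ /=.
set b := 2 * pi * (x - y).
have Ic : leb.-integrable setT (EFin \o (fun w => abel_weight a w * cos (b * w))).
  by apply: integrable_abel_weightM => //; [exact: measurable_cosM|move=> w; exact: cos_max].
have Is : leb.-integrable setT (EFin \o (fun w => abel_weight a w * sin (b * w))).
  by apply: integrable_abel_weightM => //; [exact: measurable_sinM|move=> w; exact: sin_max].
pose A := complex.Re (h x * conjc (h y)); pose B := complex.Im (h x * conjc (h y)).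
have IAc : leb.-integrable setT (EFin \o (fun w => A * (abel_weight a w * cos (b * w)))).
  exact: (integrableZl measurableT A Ic).
have IBs : leb.-integrable setT (EFin \o (fun w => B * (abel_weight a w * sin (b * w)))).
  exact: (integrableZl measurableT B Is).
have IAB : leb.-integrable setT (EFin \o (fun w =>
    A * (abel_weight a w * cos (b * w)) + B * (abel_weight a w * sin (b * w)))).
  exact: (integrableD measurableT IAc IBs).
transitivity (\int[leb]_w (A * (abel_weight a w * cos (b * w)) +
    B * (abel_weight a w * sin (b * w)))%:E)%E.
  by apply: eq_integral => w _; congr EFin; rewrite /kernel /= -/b -/A -/B; ring.
rewrite -[LHS]fineK; last exact: (integrable_fin_num measurableT IAB).
congr EFin; rewrite -[LHS]/(\int[leb]_w (A * (abel_weight a w * cos (b * w)) +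
    B * (abel_weight a w * sin (b * w))))%R.
rewrite RintegralD// !RintegralZl// Rintegral_abel_sin// Rintegral_abel_cos//.
by rewrite mulr0 addr0.
Qed.

Lemma poisson_kernel_le (a t : R) : 0 < a -> poisson_kernel a t <= 2 / a.
Proof.
move=> a0; rewrite /poisson_kernel ler_pdivrMr; last first.
  by rewrite ltr_pwDl ?sqr_ge0// exprn_even_gt0 ?gt_eqF.
have a0' : a != 0 by rewrite gt_eqF.
have -> : 2 / a * (a ^+ 2 + (2 * pi * t) ^+ 2) = 2 * a + 2 / a * (2 * pi * t) ^+ 2.
  by rewrite mulrDr; congr (_ + _); field.
by rewrite lerDl mulr_ge0 ?sqr_ge0// divr_ge0// ltW.
Qed.

Lemma measurable_poisson_diff (a : R) : 0 < a ->
  measurable_fun setT (fun z : measurableTypeR R * measurableTypeR R =>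
    poisson_kernel a (z.1 - z.2)).
Proof.
move=> a0; apply: measurableT_comp; first exact: measurable_poisson_kernel.
by apply: measurable_funB.
Qed.

Lemma integrable_poisson_form h (a : R) : 0 < a -> cLfun leb 1%:E h ->
  (leb \x leb)%E.-integrable setT (EFin \o (fun z =>
     complex.Re (h z.1 * conjc (h z.2)) * poisson_kernel a (z.1 - z.2))).
Proof.
move=> a0 Lh; have [mh _] := Lh; have In := integrable_cmod Lh.
apply: (le_integrable measurableT _ _ (integrableZl measurableT (2 / a) (integrable_tensor In In))).
  apply/measurable_EFinP; apply: measurable_funM; last exact: measurable_poisson_diff.
  have m1 : cmeasurable (fun z : measurableTypeR R * measurableTypeR R => h z.1).
    exact: (@cmeasurable_fst_comp _ _ (measurableTypeR R) (measurableTypeR R) R h mh).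
  have m2 : cmeasurable (fun z : measurableTypeR R * measurableTypeR R => h z.2).
    exact: (@cmeasurable_snd_comp _ _ (measurableTypeR R) (measurableTypeR R) R h mh).
  by case: (cmeasurableM m1 (cmeasurable_conjc m2)).
move=> [x y] _; rewrite [X in (X <= _)%E]/= [X in (_ <= X)%E]/= lee_fin.
have a2 : 0 <= 2 / a by rewrite divr_ge0// ltW.
rewrite [leRHS]normrM mulrC normrM (ger0_norm a2) ler_pM//.
  by rewrite ger0_norm ?poisson_kernel_ge0// poisson_kernel_le.
by rewrite normrM !(ger0_norm (cmod_ge0 _)) normr_Re_conjcM_le.
Qed.

Lemma poisson_marginal1 (f : measurableTypeR R -> R) (a : R) : 0 < a ->
  measurable_fun setT f -> (forall x, 0 <= f x) ->
  (\int[leb \x leb]_z (f z.1 * poisson_kernel a (z.1 - z.2))%:E =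
   \int[leb]_x (f x)%:E)%E.
Proof.
move=> a0 mf f0; rewrite fubini_tonelli1; last 2 first.
- apply/measurable_EFinP; apply: measurable_funM; last exact: measurable_poisson_diff.
  exact: measurable_fst_comp.
- by move=> z; rewrite lee_fin mulr_ge0// poisson_kernel_ge0.
apply: eq_integral => x _; rewrite /fubini_F /=.
under eq_integral do rewrite EFinM.
rewrite ge0_integralZl_EFin//.
- by rewrite integral_poisson_kernel_subl// mule1.
- by move=> y _; rewrite lee_fin poisson_kernel_ge0.
- apply/measurable_EFinP; apply: measurableT_comp; first exact: measurable_poisson_kernel.
  by apply: measurable_funB => //; exact: measurable_cst.
Qed.

Lemma poisson_marginal2 (f : measurableTypeR R -> R) (a : R) : 0 < a ->
  measurable_fun setT f -> (forall x, 0 <= f x) ->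
  (\int[leb \x leb]_z (f z.2 * poisson_kernel a (z.1 - z.2))%:E =
   \int[leb]_x (f x)%:E)%E.
Proof.
move=> a0 mf f0.
have m2 : measurable_fun setT (fun z : measurableTypeR R * measurableTypeR R =>
    (f z.2 * poisson_kernel a (z.1 - z.2))%:E).
  apply/measurable_EFinP; apply: measurable_funM; last exact: measurable_poisson_diff.
  exact: measurable_snd_comp.
have p2 (z : measurableTypeR R * measurableTypeR R) :
    (0 <= (f z.2 * poisson_kernel a (z.1 - z.2))%:E)%E.
  by rewrite lee_fin mulr_ge0// poisson_kernel_ge0.
rewrite fubini_tonelli1// fubini_tonelli//.
apply: eq_integral => y _; rewrite /fubini_G /=.
under eq_integral do rewrite EFinM -poisson_kernelN opprB.
rewrite ge0_integralZl_EFin//.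
- by rewrite integral_poisson_kernel_subl// mule1.
- by move=> x _; rewrite lee_fin poisson_kernel_ge0.
- apply/measurable_EFinP; apply: measurableT_comp; first exact: measurable_poisson_kernel.
  by apply: measurable_funB => //; exact: measurable_cst.
Qed.

(** Each of the two halves of |h (x)|^2 / 2 + |h (y)|^2 / 2 integrates to half
    the energy of h, because the Poisson kernel has mass one in either variable. *)
Lemma abel_energy_le h (a : R) : 0 < a -> cLfun leb 1%:E h -> cLfun leb 2%:E h ->
  (\int[leb]_w (abel_weight a w * csq (fourier_integral h w))%:E <= energy leb h)%E.
Proof.
move=> a0 L1 Lh; rewrite abel_energyE//; have [mh _] := Lh.
have mq : measurable_fun setT (fun x => csq (h x) / 2).
  by apply: measurable_funM => //; exact: measurable_csq.
have q0 x : 0 <= csq (h x) / 2 by rewrite divr_ge0// csq_ge0.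
pose f1 (z : measurableTypeR R * measurableTypeR R) :=
  ((csq (h z.1) / 2) * poisson_kernel a (z.1 - z.2))%:E.
pose f2 (z : measurableTypeR R * measurableTypeR R) :=
  ((csq (h z.2) / 2) * poisson_kernel a (z.1 - z.2))%:E.
have m1 : measurable_fun setT f1.
  apply/measurable_EFinP; apply: measurable_funM; last exact: measurable_poisson_diff.
  exact: measurable_fst_comp mq.
have m2 : measurable_fun setT f2.
  apply/measurable_EFinP; apply: measurable_funM; last exact: measurable_poisson_diff.
  exact: measurable_snd_comp mq.
have p1 z : (0 <= f1 z)%E by rewrite lee_fin mulr_ge0// poisson_kernel_ge0.
have p2 z : (0 <= f2 z)%E by rewrite lee_fin mulr_ge0// poisson_kernel_ge0.
have half : (\int[leb]_x (csq (h x) / 2)%:E = 2^-1%:E * energy leb h)%E.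
  rewrite /energy -ge0_integralZl_EFin//.
  - by apply: eq_integral => x _; rewrite mulrC.
  - by move=> x _; rewrite lee_fin csq_ge0.
  - exact: measurable_ecsq.
have e1 : (\int[leb \x leb]_z f1 z = 2^-1%:E * energy leb h)%E.
  by rewrite -half; exact: (poisson_marginal1 a0 mq q0).
have e2 : (\int[leb \x leb]_z f2 z = 2^-1%:E * energy leb h)%E.
  by rewrite -half; exact: (poisson_marginal2 a0 mq q0).
have ey := energy_fin_num Lh.
have e12 : (\int[leb \x leb]_z (f1 z + f2 z) = energy leb h)%E.
  rewrite ge0_integralD// e1 e2 -ge0_muleDl ?lee_fin//.
  have -> : (2^-1%:E + 2^-1%:E = 1 :> \bar R)%E by rewrite -EFinD; congr EFin; lra.
  by rewrite mul1e.
rewrite -e12; apply: le_integral => //.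
- exact: integrable_poisson_form.
- apply/integrableP; split; first exact: emeasurable_funD.
  under eq_integral do rewrite gee0_abs ?adde_ge0//.
  by rewrite e12 ltey_eq ey.
- move=> z _; rewrite /f1 /f2 -EFinD lee_fin -mulrDl ler_wpM2r ?poisson_kernel_ge0//.
  have := csq_ge0 (h z.1 - h z.2).
  have : csq (h z.1 - h z.2) = csq (h z.1) + csq (h z.2) -
     2 * complex.Re (h z.1 * conjc (h z.2)).
    by case: (h z.1) (h z.2) => [p q] [r t]; rewrite /csq /=; ring.
  by move=> ->; lra.
Qed.

Lemma abel_weight_cvg (w : R) : abel_weight (k.+1%:R^-1) w @[k --> \oo] --> (1 : R).
Proof.
rewrite -[X in _ --> X](expR0); apply: continuous_cvg; first exact: continuous_expR.
rewrite -[X in _ --> X]oppr0; apply: cvgN.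
rewrite -[X in _ --> X](mul0r `|w|); apply: cvgM; last exact: cvg_cst.
exact: cvg_harmonic.
Qed.

(** The weights tend to 1 as a tends to 0, so Fatou's lemma removes them. *)
Lemma fourier_energy_le h : cLfun leb 1%:E h -> cLfun leb 2%:E h ->
  (energy leb (fourier_integral h) <= energy leb h)%E.
Proof.
move=> L1 Lh; have [mh _] := Lh.
have mF := measurable_csq (cmeasurable_fourier_integral mh).
pose f k w := (abel_weight (k.+1%:R^-1) w * csq (fourier_integral h w))%:E.
have -> : energy leb (fourier_integral h) = (\int[leb]_w limn_einf (f^~ w))%E.
  apply: eq_integral => w _.
  have c : (f^~ w) @ \oo --> (csq (fourier_integral h w))%:E.
    apply: cvg_EFin_real; rewrite -[X in _ --> X]mul1r.
    by apply: cvgM; [exact: abel_weight_cvg|exact: cvg_cst].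
  by rewrite is_cvg_limn_einfE; [apply/esym/cvg_lim|exact: cvgP c].
apply: le_trans (fatou _ _ _ _) _ => //.
- move=> k; apply/measurable_EFinP; apply: measurable_funM => //.
  exact: measurable_abel_weight.
- by move=> k w _; rewrite lee_fin mulr_ge0 ?abel_weight_ge0 ?csq_ge0.
- apply: (@limn_einf_le _ _ _ 0) => k _.
  by apply: abel_energy_le => //; rewrite invr_gt0.
Qed.

End abel_energy.

(** * Convergence of Poisson averages and the lower Plancherel bound *)

Section poisson_approximation.
Context {R : realType}.
Local Notation leb := (@lebesgue_measure R).
Implicit Types u : measurableTypeR R -> R.

Lemma measurable_poisson_subl (a x : R) : 0 < a ->
  measurable_fun setT (fun y : measurableTypeR R => poisson_kernel a (x - y)).
Proof.
move=> a0; apply: measurableT_comp; first exact: measurable_poisson_kernel.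
by apply: measurable_funB => //; exact: measurable_cst.
Qed.

Lemma integrable_poisson_subl (a x : R) : 0 < a ->
  leb.-integrable setT (EFin \o (fun y => poisson_kernel a (x - y))).
Proof.
move=> a0; apply/integrableP; split.
  by apply/measurable_EFinP; exact: measurable_poisson_subl.
under eq_integral do rewrite /= ger0_norm ?poisson_kernel_ge0//.
by rewrite integral_poisson_kernel_subl// ltry.
Qed.

Lemma Rintegral_poisson_subl (a x : R) : 0 < a ->
  \int[leb]_y (poisson_kernel a (x - y)) = 1.
Proof. by move=> a0; rewrite /Rintegral integral_poisson_kernel_subl. Qed.

Lemma integrable_poisson_bounded u (M a x : R) : 0 < a ->
  measurable_fun setT u -> (forall y, `|u y| <= M) ->
  leb.-integrable setT (EFin \o (fun y => u y * poisson_kernel a (x - y))).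
Proof.
move=> a0 mu uM.
have M0 : 0 <= M by exact: le_trans (normr_ge0 (u 0)) (uM 0).
apply: (le_integrable measurableT _ _
  (integrableZl measurableT M (integrable_poisson_subl x a0))).
  apply/measurable_EFinP; apply: measurable_funM => //.
  exact: measurable_poisson_subl.
move=> y _; rewrite /= lee_fin !normrM (ger0_norm M0).
by rewrite ler_wpM2r.
Qed.

Definition poisson_mean (a : R) u (x : R) : R :=
  \int[leb]_y (u y * poisson_kernel a (x - y)).

Lemma normr_poisson_mean_le u (M a x : R) : 0 < a ->
  measurable_fun setT u -> (forall y, `|u y| <= M) ->
  `|poisson_mean a u x| <= M.
Proof.
move=> a0 mu uM.
have Iu := integrable_poisson_bounded x a0 mu uM.
rewrite (le_trans (le_normr_Rintegral measurableT Iu))//.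
have IM := integrableZl measurableT M (integrable_poisson_subl x a0).
rewrite -[leRHS]mulr1 -(Rintegral_poisson_subl x a0) -RintegralZl//; last first.
  exact: integrable_poisson_subl.
apply: le_Rintegral => //.
  exact: (integrable_norm Iu).
move=> y _; rewrite normrM (ger0_norm (poisson_kernel_ge0 _ a0)).
by rewrite ler_wpM2r ?poisson_kernel_ge0.
Qed.

(** Away from the origin the kernels are O(a) relatively to the fixed integrable
    kernel of parameter 1, so their mass there tends to 0 with a. *)
Lemma poisson_kernel_tail (a d t : R) : 0 < a -> 0 < d -> d <= `|t| ->
  poisson_kernel a t <= (1 + (2 * pi * d) ^- 2) * a * poisson_kernel 1 t.
Proof.
move=> a0 d0 dt; rewrite /poisson_kernel expr1n mulr1.
have pd : 0 < 2 * pi * d by rewrite !mulr_gt0// pi_gt0.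
have t2 : (2 * pi * d) ^+ 2 <= (2 * pi * t) ^+ 2.
  rewrite (exprMn _ (2 * pi) d) (exprMn _ (2 * pi) t) ler_pM2l; last first.
    by rewrite exprn_gt0// mulr_gt0// pi_gt0.
  by rewrite -(real_normK (num_real t)) ler_pXn2r// nnegrE ltW.
move: t2; set T := (2 * pi * t) ^+ 2; set D := (2 * pi * d) ^+ 2 => t2.
have D0 : 0 < D by rewrite exprn_gt0.
have T0 : 0 < T by exact: lt_le_trans D0 t2.
have a20 : 0 < a ^+ 2 + T by rewrite ltr_wpDl ?sqr_ge0.
have T10 : 0 < 1 + T by rewrite addr_gt0.
rewrite ler_pdivrMr//.
have -> : (1 + D^-1) * a * (2 / (1 + T)) * (a ^+ 2 + T) =
  2 * a * (((1 + D^-1) * (a ^+ 2 + T)) / (1 + T)) by ring.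
rewrite ler_peMr ?mulr_ge0 ?(ltW a0)// ler_pdivlMr// mul1r.
have DT : 1 <= D^-1 * T by rewrite mulrC ler_pdivlMr// mul1r.
have := sqr_ge0 a; have : 0 <= D^-1 * a ^+ 2 by rewrite mulr_ge0 ?sqr_ge0// invr_ge0 ltW.
by lra.
Qed.

(** Near x the continuity of u is used, and away from x the smallness of the
    kernel; the two ranges are covered by a single pointwise majorant of the
    integrand. *)
Lemma poisson_mean_cvg u (M x : R) : measurable_fun setT u ->
  (forall y, `|u y| <= M) -> {for x, continuous (u : R -> R)} ->
  poisson_mean (k.+1%:R^-1) u x @[k --> \oo] --> u x.
Proof.
move=> mu uM cu.
have M0 : 0 <= M by exact: le_trans (normr_ge0 (u 0)) (uM 0).
apply/cvgrPdist_le => e e0.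
have e2 : 0 < e / 2 by rewrite divr_gt0.
have /cvgrPdist_le/(_ _ e2)/nbhs_ballP[d /= d0 du] := cu.
(* 2 M bounds the oscillation of u; the other factor is the constant of the
   kernel tail beyond distance d *)
pose C := 2 * M * (1 + (2 * pi * d) ^- 2).
have C0 : 0 <= C.
  by rewrite !mulr_ge0// addr_ge0// invr_ge0 sqr_ge0.
have key a : 0 < a -> `|u x - poisson_mean a u x| <= e / 2 + C * a.
  move=> a0.
  have Ip := integrable_poisson_subl x a0.
  have Ip1 := integrable_poisson_subl x (@ltr01 R).
  have Iu := integrable_poisson_bounded x a0 mu uM.
  have Ix : leb.-integrable setT (EFin \o (fun y => u x * poisson_kernel a (x - y))).
    exact: (integrableZl measurableT (u x) Ip).
  have -> : u x - poisson_mean a u x =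
      \int[leb]_y (u x * poisson_kernel a (x - y) - u y * poisson_kernel a (x - y)).
    by rewrite RintegralB// RintegralZl// Rintegral_poisson_subl// mulr1.
  have Id : leb.-integrable setT (EFin \o (fun y =>
      u x * poisson_kernel a (x - y) - u y * poisson_kernel a (x - y))).
    exact: (integrableB measurableT Ix Iu).
  have I1 : leb.-integrable setT (EFin \o (fun y => e / 2 * poisson_kernel a (x - y))).
    exact: (integrableZl measurableT (e / 2) Ip).
  have I2 : leb.-integrable setT (EFin \o (fun y => C * a * poisson_kernel 1 (x - y))).
    exact: (integrableZl measurableT (C * a) Ip1).
  have I12 : leb.-integrable setT (EFin \o (fun y =>
      e / 2 * poisson_kernel a (x - y) + C * a * poisson_kernel 1 (x - y))).
    exact: (integrableD measurableT I1 I2).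
  rewrite (le_trans (le_normr_Rintegral measurableT Id))//.
  apply: (@le_trans _ _ (\int[leb]_y
      (e / 2 * poisson_kernel a (x - y) + C * a * poisson_kernel 1 (x - y)))).
    apply: le_Rintegral => //; first exact: (integrable_norm Id).
    move=> y _; rewrite -mulrBl normrM (ger0_norm (poisson_kernel_ge0 _ a0)).
    have p0 := poisson_kernel_ge0 (x - y) a0.
    have p1 := poisson_kernel_ge0 (x - y) (@ltr01 R).
    have [xyd|dxy] := ltP `|x - y| d.
      rewrite (@le_trans _ _ (e / 2 * poisson_kernel a (x - y)))//.
        by rewrite ler_wpM2r//; apply: du.
      by rewrite lerDl; apply: mulr_ge0 => //; apply: mulr_ge0 => //; exact: ltW.
    have uxy : `|u x - u y| <= 2 * M.
      by rewrite (le_trans (ler_normB _ _))// mulr_natl mulr2n lerD.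
    apply: (@le_trans _ _ (2 * M * poisson_kernel a (x - y))).
      by rewrite ler_wpM2r.
    apply: (@le_trans _ _ (C * a * poisson_kernel 1 (x - y))); last first.
      by rewrite lerDr; apply: mulr_ge0 => //; exact: ltW.
    have -> : C * a * poisson_kernel 1 (x - y) =
        2 * M * ((1 + (2 * pi * d) ^- 2) * a * poisson_kernel 1 (x - y)).
      by rewrite /C !mulrA.
    apply: ler_wpM2l; first exact: mulr_ge0.
    exact: poisson_kernel_tail.
  rewrite RintegralD// (RintegralZl _ measurableT Ip) (RintegralZl _ measurableT Ip1).
  by rewrite (Rintegral_poisson_subl x a0) (Rintegral_poisson_subl x (@ltr01 R)) !mulr1.
have hC : C * k.+1%:R^-1 @[k --> \oo] --> (0 : R).
  rewrite -[X in _ --> X](mulr0 C); apply: cvgM; first exact: cvg_cst.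
  exact: cvg_harmonic.
have /cvgrPdist_le/(_ _ e2) := hC; apply: filterS => k; rewrite sub0r normrN.
rewrite ger0_norm; last by apply: mulr_ge0 => //; rewrite invr_ge0.
move=> hk.
have k0 : 0 < k.+1%:R^-1 :> R by rewrite invr_gt0.
by rewrite (le_trans (key _ k0))// [leRHS]splitr lerD2l.
Qed.

End poisson_approximation.

Section plancherel_lower.
Context {R : realType}.
Local Notation leb := (@lebesgue_measure R).
Implicit Types h f : measurableTypeR R -> R[i].

(** A class that is dense in L^2.  Vanishing at the end points, where continuity
    may fail, makes the products of a function with its Poisson averages
    converge everywhere. *)
Definition truncated_continuous f : Prop := exists K M : R,
  [/\ cmeasurable f, forall x, cmod (f x) <= M,
      forall x, K <= `|x| -> f x = 0
    & forall x, `|x| < K ->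
        {for x, continuous (fun y : R => complex.Re (f y) : R)} /\
        {for x, continuous (fun y : R => complex.Im (f y) : R)}].

Lemma integral_truncated_lt_pinfty (F : measurableTypeR R -> R) (K M : R) :
  (forall x, 0 <= F x <= M) -> (forall x, K <= `|x| -> F x = 0) ->
  measurable_fun setT F -> (\int[leb]_x (F x)%:E < +oo)%E.
Proof.
move=> FM FK mF.
pose I : set (measurableTypeR R) := `[- K, K]%classic.
have mI : measurable I by exact: measurable_itv.
have M0 : 0 <= M by have /andP[] := FM 0; exact: le_trans.
apply: (@le_lt_trans _ _ (\int[leb]_(x in I) M%:E)%E); last first.
  rewrite integral_cst//; apply: lte_mul_pinfty; rewrite ?lee_fin//.
  suff : ((@lebesgue_measure R) I < +oo)%E by [].
  by rewrite /I lebesgue_measure_itv/=; case: ifP => _; rewrite -?EFinB ltry.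
rewrite [leRHS]integral_mkcond; apply: ge0_le_integral => //.
- by move=> x _; rewrite lee_fin; case/andP: (FM x).
- exact/measurable_EFinP.
- have mc : measurable_fun I (fun=> M%:E) by exact: measurable_cst.
  by have := (measurable_restrictT (fun=> M%:E) mI).1 mc.
- move=> x _; rewrite patchE; case: ifPn => [_|xI].
    by rewrite lee_fin; case/andP: (FM x).
  rewrite FK//; move: xI; rewrite notin_setE /I /= in_itv/= -ler_norml => /negP.
  by rewrite -ltNge => /ltW.
Qed.

Lemma truncated_continuous_Lfun f : truncated_continuous f ->
  cLfun leb 1%:E f /\ cLfun leb 2%:E f.
Proof.
move=> [K [M [mf fM fK _]]]; split.
  split=> //; rewrite cLnorm1E; apply: (@integral_truncated_lt_pinfty _ K M).
  - by move=> x; rewrite cmod_ge0 fM.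
  - by move=> x /fK ->; rewrite /= expr0n addr0 sqrtr0.
  - exact: measurable_cmod.
apply/cLfun2P; split=> //; apply: (@integral_truncated_lt_pinfty _ K (M ^+ 2)).
- move=> x; rewrite csq_ge0 -sqr_cmod ler_pXn2r ?fM ?nnegrE ?cmod_ge0//.
  exact: le_trans (cmod_ge0 _) (fM x).
- by move=> x /fK ->; rewrite csq0.
- exact: measurable_csq.
Qed.

Lemma abel_energy_le_fourier f (a : R) : 0 < a -> cmeasurable f ->
  (\int[leb]_w (abel_weight a w * csq (fourier_integral f w))%:E <=
   energy leb (fourier_integral f))%E.
Proof.
move=> a0 mf; have mF := measurable_csq (cmeasurable_fourier_integral mf).
apply: ge0_le_integral => //.
- by move=> w _; rewrite lee_fin mulr_ge0 ?abel_weight_ge0 ?csq_ge0.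
- apply/measurable_EFinP; apply: measurable_funM => //.
  exact: measurable_abel_weight.
- exact/measurable_EFinP.
- move=> w _; rewrite lee_fin ler_piMl ?csq_ge0// /abel_weight -expR0 ler_expR.
  by rewrite oppr_le0 mulr_ge0// ltW.
Qed.

(** Fubini writes the weighted energy as the integral of f (x) against the
    Poisson average of the conjugate of f at x.  These integrands are bounded
    and vanish outside a bounded interval, where they converge to |f (x)|^2. *)
Lemma energy_le_fourier f : truncated_continuous f ->
  (energy leb f <= energy leb (fourier_integral f))%E.
Proof.
move=> tf; have [L1 L2] := truncated_continuous_Lfun tf.
have [K [M [mf fM fK cf]]] := tf.
have M0 : 0 <= M by exact: le_trans (cmod_ge0 _) (fM 0).
pose u x := complex.Re (f x); pose v x := complex.Im (f x).
have [mu mv] : measurable_fun setT u /\ measurable_fun setT v by case: mf.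
have uM x : `|u x| <= M by exact: le_trans (normr_Re_le _) (fM x).
have vM x : `|v x| <= M by exact: le_trans (normr_Im_le _) (fM x).
pose a k : R := k.+1%:R^-1.
have a0 k : 0 < a k by rewrite invr_gt0.
pose F k x := u x * poisson_mean (a k) u x + v x * poisson_mean (a k) v x.
have IF k : (\int[leb]_w (abel_weight (a k) w * csq (fourier_integral f w))%:E =
    \int[leb]_x (F k x)%:E)%E.
  rewrite abel_energyE// -(integral12_prod_meas1 (integrable_poisson_form (a0 k) L1)).
  apply: eq_integral => x _; rewrite /fubini_F.
  have Iu := integrable_poisson_bounded x (a0 k) mu uM.
  have Iv := integrable_poisson_bounded x (a0 k) mv vM.
  have Iu' : leb.-integrable setT (EFin \o (fun y => u x * (u y * poisson_kernel (a k) (x - y)))).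
    exact: (integrableZl measurableT (u x) Iu).
  have Iv' : leb.-integrable setT (EFin \o (fun y => v x * (v y * poisson_kernel (a k) (x - y)))).
    exact: (integrableZl measurableT (v x) Iv).
  rewrite /F /poisson_mean -!RintegralZl// -RintegralD// /Rintegral fineK.
    apply: eq_integral => y _ /=; congr EFin; rewrite /u /v.
    by case: (f x) (f y) => [p q] [r t] /=; ring.
  apply: integrable_fin_num => //.
  exact: (integrableD measurableT Iu' Iv').
have mF k : measurable_fun setT (fun x => (F k x)%:E).
  have mz (w : measurableTypeR R -> R) : measurable_fun setT w ->
      measurable_fun setT (poisson_mean (a k) w).
    move=> mw; have mp : measurable_fun setT
        (fun z : measurableTypeR R * measurableTypeR R =>
           w z.2 * poisson_kernel (a k) (z.1 - z.2)).
      apply: measurable_funM; last exact: measurable_poisson_diff.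
      exact: measurable_snd_comp.
    exact: (measurable_integral_section leb mp).
  by apply/measurable_EFinP; apply: measurable_funD; apply: measurable_funM => //; exact: mz.
pose I : set (measurableTypeR R) := `]- K, K[%classic.
pose g x := (2 * M ^+ 2 * \1_I x)%:E.
have cF : (\int[leb]_x (F k x)%:E)%E @[k --> \oo] --> energy leb f.
  apply: (@dominated_cvg _ _ _ leb setT measurableT _ _ g) => //.
  - move=> x _; apply: cvg_EFin_real.
    have [Kx|xK] := leP K `|x|.
      rewrite /F /u /v fK// csq0; under eq_fun do rewrite /= !mul0r addr0.
      exact: cvg_cst.
    have [cu cv] := cf _ xK.
    rewrite /csq !expr2; apply: cvgD; apply: cvgM; try exact: cvg_cst.
      exact: poisson_mean_cvg mu uM cu.
    exact: poisson_mean_cvg mv vM cv.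
  - have mI : measurable I by exact: measurable_itv.
    have Ii : leb.-integrable setT (EFin \o (\1_I : measurableTypeR R -> R)).
      exact: integrable_indic_itv.
    exact: (integrableZl measurableT (2 * M ^+ 2) Ii).
  - move=> k x _; rewrite lee_fin.
    have [Kx|xK] := leP K `|x|.
      by rewrite /F /u /v fK// !mul0r addr0 normr0 mulr_ge0// mulr_ge0// sqr_ge0.
    rewrite indicE mem_set ?mulr1; last by rewrite /I /= in_itv/= -ltr_norml.
    rewrite /F (le_trans (ler_normD _ _))// mulr_natl mulr2n !normrM expr2.
    by rewrite lerD// ler_pM// normr_poisson_mean_le.
rewrite -(cvg_lim _ cF)//; apply: lime_le; first exact: cvgP cF.
apply: nearW => k; rewrite -IF; exact: abel_energy_le_fourier.
Qed.

End plancherel_lower.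

(** * A dense class of functions *)

Section density.
Context {R : realType}.
Local Notation leb := (@lebesgue_measure R).
Implicit Types h f : measurableTypeR R -> R[i].

Let truncation (K : R) h (x : measurableTypeR R) : R[i] :=
  if (`|x| < K) && (cmod (h x) <= K) then h x else 0.

Let cmeasurable_truncation K h : cmeasurable h -> cmeasurable (truncation K h).
Proof.
move=> mh; have [hR hI] := mh.
have mb : measurable_fun setT (fun x : measurableTypeR R => (`|x| < K) && (cmod (h x) <= K)).
  apply: measurable_and.
    by apply: measurable_fun_ltr => //; exact: measurableT_comp.
  by apply: measurable_fun_ler => //; exact: measurable_cmod.
split.
  rewrite (_ : (fun _ => _) = (fun x : measurableTypeR R =>
      if (`|x| < K) && (cmod (h x) <= K) then complex.Re (h x) else 0)).
    by apply: measurable_fun_ifT.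
  by apply/funext => x; rewrite /truncation; case: ifP.
rewrite (_ : (fun _ => _) = (fun x : measurableTypeR R =>
    if (`|x| < K) && (cmod (h x) <= K) then complex.Im (h x) else 0)).
  by apply: measurable_fun_ifT.
by apply/funext => x; rewrite /truncation; case: ifP.
Qed.

Let truncation_cvg h : cLfun leb 2%:E h ->
  energy leb (fun x => h x - truncation k%:R h x) @[k --> \oo] --> (0 : \bar R)%E.
Proof.
move=> Lh; have [mh _] := Lh.
rewrite (_ : 0%E = (\int[leb]_x (cst 0 x))%E); last by rewrite integral0.
apply: (@dominated_cvg _ _ _ leb setT measurableT _ _ (fun x => (csq (h x))%:E)) => //.
- move=> k; apply: measurable_ecsq; apply: cmeasurableB => //.
  exact: cmeasurable_truncation.
- move=> x _; apply: cvg_EFin_real; apply: cvg_near_cst.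
  near=> k; rewrite /truncation ifT ?subrr ?csq0//; apply/andP; split.
    by near: k; exact: nbhs_infty_gtr.
  by near: k; exact: nbhs_infty_ger.
- exact: integrable_csq.
- move=> k x _; rewrite gee0_abs ?lee_fin ?csq_ge0// /truncation.
  by case: ifP => _; rewrite ?subrr ?csq0 ?csq_ge0// subr0.
Unshelve. all: by end_near. Qed.

(** The projection on [-K, K], in a form whose continuity is immediate. *)
Let clamp (K t : R) : R := (`|t + K| - `|t - K|) / 2.

Let clamp_norm K t : 0 <= K -> `|clamp K t| <= K.
Proof.
move=> K0; rewrite /clamp ler_norml.
by case: (ger0P (t + K)) => ?; case: (ger0P (t - K)) => ?; apply/andP; split; lra.
Qed.

Let clamp_dist K t u : `|u| <= K -> `|u - clamp K t| <= `|u - t|.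
Proof.
rewrite ler_norml => /andP[u1 u2]; rewrite /clamp.
case: (ger0P (t + K)) => ?; case: (ger0P (t - K)) => ?;
case: (ger0P (u - t)) => ?; rewrite ler_norml; apply/andP; split; lra.
Qed.

Let continuous_clamp K : continuous (clamp K).
Proof.
move=> t; apply: cvgM; last exact: cvg_cst.
apply: cvgB.
  apply: (@continuous_comp _ _ _ (fun t => t + K) (fun t => `|t|)); last exact: norm_continuous.
  by apply: cvgD => //; exact: cvg_cst.
apply: (@continuous_comp _ _ _ (fun t => t - K) (fun t => `|t|)); last exact: norm_continuous.
by apply: cvgB => //; exact: cvg_cst.
Qed.

(** A continuous L^1 approximation, projected on [-K, K], approximates in L^2 as
    well: the square of a difference of numbers in [-K, K] is at most 2 K times
    its absolute value. *)
Let continuous_approx (u : R -> R) (K e : R) : 0 < K -> 0 < e ->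
  measurable_fun setT (u : measurableTypeR R -> R) -> (forall x, `|u x| <= K) ->
  exists c : R -> R, [/\ continuous c, forall x, `|c x| <= K &
    (\int[leb]_(x in `](- K)%R, K%R[) ((u x - c x) ^+ 2)%:E <= e%:E)%E].
Proof.
move=> K0 e0 mu uK.
pose E : set (measurableTypeR R) := `]- K, K[%classic.
have mE : measurable E by exact: measurable_itv.
have Ey : (leb E < +oo)%E.
  suff : ((@lebesgue_measure R) E < +oo)%E by [].
  by rewrite /E lebesgue_measure_itv/=; case: ifP => _; rewrite -?EFinB ltry.
have Iu : leb.-integrable E (EFin \o u).
  apply: measurable_bounded_integrable => //; first exact: measurable_funTS.
  exists K; split; first exact: num_real.
  by move=> M KM x _; rewrite /= (le_trans (uK x))// ltW.
have [g [cg Ig gu]] := approximation_continuous_integrable mE Ey Iu.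
have e' : (0 < (e / (2 * K))%:E)%E by rewrite lte_fin divr_gt0// mulr_gt0.
have [n gn] : exists n, (\int[leb]_(x in E) `|(u x - g n x)%:E| <= (e / (2 * K))%:E)%E.
  move/fine_cvgP : gu => [gf /cvgrPdist_le/(_ (e / (2 * K)))].
  rewrite divr_gt0 ?mulr_gt0// => /(_ isT) gd.
  near \oo => n; exists n.
  rewrite -[leLHS]fineK; last by near: n; exact: gf.
  have : `|0 - fine (\int[leb]_(x in E) `|(u x - g n x)%:E|)%E| <= e / (2 * K).
    by near: n; exact: gd.
  by rewrite sub0r normrN lee_fin; apply: le_trans; rewrite ler_norm.
exists (fun x => clamp K (g n x)); split.
- move=> x; apply: continuous_comp; first exact: cg.
  exact: continuous_clamp.
- by move=> x; rewrite clamp_norm// ltW.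
- have mg : measurable_fun setT (g n : measurableTypeR R -> R).
    by apply: continuous_measurable_fun; exact: cg.
  have mc : measurable_fun setT (fun x : measurableTypeR R => clamp K (g n x)).
    apply: (measurableT_comp (f := clamp K)) => //.
    by apply: continuous_measurable_fun; exact: continuous_clamp.
  apply: (@le_trans _ _ (\int[leb]_(x in E) ((2 * K)%:E * `|(u x - g n x)%:E|))%E).
    apply: ge0_le_integral => //.
    + by move=> x _; rewrite lee_fin sqr_ge0.
    + apply/measurable_EFinP; apply: measurable_funTS; apply: measurable_funX.
      exact: measurable_funB.
    + apply: emeasurable_funM => //; apply: measurableT_comp => //.
      by apply/measurable_EFinP; apply: measurable_funTS; exact: measurable_funB.
    + move=> x _; rewrite -EFinM lee_fin -(real_normK (num_real _)) expr2.
      rewrite ler_pM//; last exact: clamp_dist.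
      rewrite (le_trans (ler_normB _ _))// mulr_natl mulr2n lerD// clamp_norm//.
      exact: ltW.
  rewrite ge0_integralZl_EFin//.
  + apply: (@le_trans _ _ ((2 * K)%:E * (e / (2 * K))%:E)%E).
      by rewrite lee_pmul2l// lte_fin mulr_gt0.
    by rewrite -EFinM lee_fin mulrC divfK// gt_eqF// mulr_gt0.
  + apply: measurableT_comp => //.
    by apply/measurable_EFinP; apply: measurable_funTS; exact: measurable_funB.
  + by rewrite mulr_ge0// ltW.
Unshelve. all: by end_near. Qed.

(** Truncating h in size and in support reduces to bounded functions on a
    bounded interval; their real and imaginary parts are then approximated by
    continuous functions, cut to the same interval. *)
Lemma truncated_continuous_dense h (e : R) : cLfun leb 2%:E h -> 0 < e ->
  exists2 f, truncated_continuous f & (energy leb (fun x => h x - f x)%R <= e%:E)%E.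
Proof.
move=> Lh e0; have [mh _] := Lh.
have e4 : 0 < e / 4 by rewrite divr_gt0.
have e8 : 0 < e / 8 by rewrite divr_gt0.
have [K K0 hs] : exists2 K : R, 0 < K &
    (energy leb (fun x => h x - truncation K h x)%R <= (e / 4)%:E)%E.
  move/fine_cvgP : (truncation_cvg Lh) => [gf /cvgrPdist_le/(_ (e / 4) e4) gd].
  near \oo => n; exists n%:R; first by near: n; exact: nbhs_infty_gtr.
  rewrite -[leLHS]fineK; last by near: n; exact: gf.
  have : `|0 - fine (energy leb (fun x => h x - truncation n%:R h x)%R)| <= e / 4.
    by near: n; exact: gd.
  by rewrite sub0r normrN lee_fin; apply: le_trans; rewrite ler_norm.
pose s := truncation K h.
have ms : cmeasurable s by exact: cmeasurable_truncation.
have sK x : cmod (s x) <= K.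
  by rewrite /s /truncation; case: ifP => [/andP[]//|_]; rewrite /= expr0n addr0 sqrtr0 ltW.
have s0 x : K <= `|x| -> s x = 0.
  by rewrite /s /truncation => Kx; rewrite ltNge Kx.
have [c1 [cc1 c1K c1s]] := continuous_approx K0 e8 ms.1
  (fun x => le_trans (normr_Re_le _) (sK x)).
have [c2 [cc2 c2K c2s]] := continuous_approx K0 e8 ms.2
  (fun x => le_trans (normr_Im_le _) (sK x)).
(* the cut creates jumps at -K and K only, outside the open interval *)
pose f (x : measurableTypeR R) : R[i] := if `|x| < K then Complex (c1 x) (c2 x) else 0.
have mb : measurable_fun setT (fun x : measurableTypeR R => `|x| < K).
  by apply: measurable_fun_ltr => //; exact: measurableT_comp.
have mc1 : measurable_fun setT (c1 : measurableTypeR R -> R).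
  by apply: continuous_measurable_fun; exact: cc1.
have mc2 : measurable_fun setT (c2 : measurableTypeR R -> R).
  by apply: continuous_measurable_fun; exact: cc2.
have mf : cmeasurable f.
  split.
    rewrite (_ : (fun _ => _) = (fun x : measurableTypeR R => if `|x| < K then c1 x else 0)).
      exact: measurable_fun_ifT.
    by apply/funext => x; rewrite /f; case: ifP.
  rewrite (_ : (fun _ => _) = (fun x : measurableTypeR R => if `|x| < K then c2 x else 0)).
    exact: measurable_fun_ifT.
  by apply/funext => x; rewrite /f; case: ifP.
have near_in (x : R) : `|x| < K -> \forall y \near x, `|y| < K.
  move=> xK; have idx : (fun y : R => `|y|) y @[y --> x] --> `|x| by exact: norm_continuous.
  exact: (@cvgr_lt _ _ _ _ _ _ idx K xK).
exists f.
  exists K, (2 * K); split=> //.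
  - move=> x; rewrite /f; case: ifP => [_|_]; last first.
      by rewrite /= expr0n addr0 sqrtr0 mulr_ge0// ltW.
    rewrite -(@ler_pXn2r _ 2) ?nnegrE ?cmod_ge0 ?mulr_ge0 ?(ltW K0)// sqr_cmod /csq /=.
    have : c1 x ^+ 2 <= K ^+ 2 by rewrite -(real_normK (num_real (c1 x))) ler_pXn2r ?nnegrE ?(ltW K0).
    have : c2 x ^+ 2 <= K ^+ 2 by rewrite -(real_normK (num_real (c2 x))) ler_pXn2r ?nnegrE ?(ltW K0).
    by have := sqr_ge0 K; lra.
  - by move=> x Kx; rewrite /f ltNge Kx.
  - move=> x xK; split.
      have fx : complex.Re (f x) = c1 x by rewrite /f xK.
      suff : complex.Re (f y) @[y --> x] --> c1 x by rewrite -fx.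
      apply: cvg_trans (cc1 x).
      by apply: near_eq_cvg; apply: filterS (near_in x xK) => y yK; rewrite /f yK.
    have fx : complex.Im (f x) = c2 x by rewrite /f xK.
    suff : complex.Im (f y) @[y --> x] --> c2 x by rewrite -fx.
      apply: cvg_trans (cc2 x).
    by apply: near_eq_cvg; apply: filterS (near_in x xK) => y yK; rewrite /f yK.
have sf : (energy leb (fun x => s x - f x)%R <= (e / 4)%:E)%E.
  pose E : set (measurableTypeR R) := `]- K, K[%classic.
  have mE : measurable E by exact: measurable_itv.
  have m1 : measurable_fun setT (fun x : measurableTypeR R => (complex.Re (s x) - c1 x) ^+ 2).
    by apply: measurable_funX; apply: measurable_funB => //; case: ms.
  have m2 : measurable_fun setT (fun x : measurableTypeR R => (complex.Im (s x) - c2 x) ^+ 2).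
    by apply: measurable_funX; apply: measurable_funB => //; case: ms.
  have -> : energy leb (fun x => s x - f x)%R = (\int[leb]_(x in E)
      (((complex.Re (s x) - c1 x) ^+ 2)%:E + ((complex.Im (s x) - c2 x) ^+ 2)%:E))%E.
    rewrite [RHS]integral_mkcond; apply: eq_integral => x _; rewrite patchE.
    case: ifPn => [|xE].
      rewrite inE /E /= in_itv/= -ltr_norml => xK.
      by rewrite /f xK /csq ReB ImB /= EFinD.
    have Kx : K <= `|x|.
      by move: xE; rewrite notin_setE /E /= in_itv/= -ltr_norml => /negP; rewrite -leNgt.
    by rewrite s0// /f ltNge Kx /= subrr csq0.
  rewrite ge0_integralD//.
  + rewrite (_ : e / 4 = e / 8 + e / 8); last by lra.
    by rewrite EFinD leeD.
  + by move=> x _; rewrite lee_fin sqr_ge0.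
  + by apply/measurable_EFinP; exact: measurable_funTS.
  + by move=> x _; rewrite lee_fin sqr_ge0.
  + by apply/measurable_EFinP; exact: measurable_funTS.
have := energyB_le leb (cmeasurableB mh ms) (cmeasurableB mf ms).
rewrite (energyBC leb f s) => H.
apply: (@le_trans _ _ (2%:E * (e / 4)%:E + 2%:E * (e / 4)%:E)%E).
  have -> : energy leb (fun x => h x - f x)%R =
      energy leb (fun x => (h x - s x) - (f x - s x)%R).
    by apply: eq_energy => x; rewrite opprB addrA subrK.
  by apply: le_trans H _; rewrite leeD// lee_pmul2l.
by rewrite -!EFinM -EFinD lee_fin; lra.
Unshelve. all: by end_near. Qed.

End density.

Section fourier_plancherel.
Context {R : realType}.
Local Notation leb := (@lebesgue_measure R).
Implicit Types h f F : measurableTypeR R -> R[i].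

Lemma fourier_integralB f h (w : R) : cLfun leb 1%:E f -> cLfun leb 1%:E h ->
  fourier_integral (fun x => f x - h x) w = fourier_integral f w - fourier_integral h w.
Proof.
move=> Lf Lh; have [fR fI] := integrable_fourier w Lf.
have [hR hI] := integrable_fourier w Lh.
apply/eqP; rewrite eq_complex ReB ImB; apply/andP; split; apply/eqP => /=.
  by rewrite -RintegralB//; apply: eq_Rintegral => x _; rewrite mulrBl ReB.
by rewrite -RintegralB//; apply: eq_Rintegral => x _; rewrite mulrBl ImB.
Qed.

Lemma cLfun1B f h : cLfun leb 1%:E f -> cLfun leb 1%:E h ->
  cLfun leb 1%:E (fun x => f x - h x).
Proof.
move=> Lf Lh; have [[mf _] [mh _]] := (Lf, Lh).
split; first exact: cmeasurableB.
rewrite cLnorm1E.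
have := integrableD measurableT (integrable_cmod Lf) (integrable_cmod Lh).
move=> /integrableP[_]; apply: le_lt_trans.
apply: ge0_le_integral => //.
- by move=> x _; rewrite lee_fin cmod_ge0.
- by apply/measurable_EFinP; apply: measurable_cmod; exact: cmeasurableB.
- apply: measurableT_comp => //; apply: emeasurable_funD.
    by apply/measurable_EFinP; exact: measurable_cmod.
  by apply/measurable_EFinP; exact: measurable_cmod.
- move=> x _; rewrite gee0_abs ?adde_ge0 ?lee_fin ?cmod_ge0//=.
  rewrite ?lee_fin -[leLHS](ger0_norm (cmod_ge0 _)).
  rewrite -(@ler_pXn2r _ 2) ?nnegrE ?addr_ge0 ?normr_ge0 ?cmod_ge0//.
  rewrite real_normK ?num_real// sqr_cmod sqrrD !sqr_cmod.
  have := normr_Re_conjcM_le (f x) (h x); rewrite ler_norml => /andP[+ _].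
  have -> : csq (f x - h x) = csq (f x) + csq (h x) - 2 * complex.Re (f x * conjc (h x)).
    by case: (f x) (h x) => [p q] [r t]; rewrite /csq /=; ring.
  by rewrite -mulr_natl; lra.
Qed.

Lemma energy_fourierB_le f h :
  cLfun leb 1%:E f -> cLfun leb 2%:E f -> cLfun leb 1%:E h -> cLfun leb 2%:E h ->
  (energy leb (fun w => fourier_integral f w - fourier_integral h w)%R
     <= energy leb (fun x => f x - h x)%R)%E.
Proof.
move=> f1 f2 h1 h2; apply: le_trans (fourier_energy_le (cLfun1B f1 h1) (cLfun2B f2 h2)).
by rewrite le_eqVlt; apply/orP; left; apply/eqP/eq_energy => w; rewrite fourier_integralB.
Qed.

End fourier_plancherel.

(** * The Fourier-Plancherel transform *)

Section fourierL2.
Context {R : realType}.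
Local Notation leb := (@lebesgue_measure R).
Implicit Types h f F : measurableTypeR R -> R[i].

Lemma cvge0_near_le (u : nat -> \bar R) (e : R) :
  u k @[k --> \oo] --> 0%E -> 0 < e -> \forall k \near \oo, (u k <= e%:E)%E.
Proof.
move=> /fine_cvgP[uf /cvgrPdist_le/(_ e) ue] e0.
near=> k; rewrite -[leLHS]fineK; last by near: k; exact: uf.
have : `|0 - fine (u k)| <= e by near: k; exact: ue.
by rewrite sub0r normrN lee_fin; apply: le_trans; rewrite ler_norm.
Unshelve. all: by end_near. Qed.

(** Approximants of h from the dense class that converge fast enough have a
    rapidly Cauchy sequence of Fourier integrals. *)
Lemma fourierL2_exists h : cLfun leb 2%:E h -> exists F, is_fourierL2 h F.
Proof.
move=> Lh; have [mh _] := Lh.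
have e0 j : 0 < (half_pow j ^+ 2 / 4 : R).
  by rewrite divr_gt0// exprn_gt0// half_pow_gt0.
pose p j := cid2 (truncated_continuous_dense Lh (e0 j)).
pose f j := projT1 (p j).
have tf j : truncated_continuous (f j) by rewrite /f; case: (p j).
have hf j : (energy leb (fun x => h x - f j x)%R <= (half_pow j ^+ 2 / 4)%:E)%E.
  by rewrite /f; case: (p j).
have L12 j := truncated_continuous_Lfun (tf j).
have mf j : cmeasurable (f j) by have [[]] := L12 j.
have cauchy j k : (j <= k)%N -> (energy leb (fun w =>
    fourier_integral (f j) w - fourier_integral (f k) w)%R <= (half_pow j ^+ 2)%:E)%E.
  move=> jk; apply: le_trans (energy_fourierB_le (L12 j).1 (L12 j).2 (L12 k).1 (L12 k).2) _.
  have -> : energy leb (fun x => f j x - f k x)%R =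
      energy leb (fun x => (h x - f k x) - (h x - f j x))%R.
    by apply: eq_energy => x; ring.
  apply: le_trans (energyB_le leb (cmeasurableB mh (mf k)) (cmeasurableB mh (mf j))) _.
  apply: (@le_trans _ _ (2%:E * (half_pow k ^+ 2 / 4)%:E + 2%:E * (half_pow j ^+ 2 / 4)%:E)%E).
    by rewrite leeD// lee_pmul2l.
  rewrite -!EFinM -EFinD lee_fin.
  have : half_pow k ^+ 2 <= half_pow j ^+ 2 :> R.
    rewrite ler_pXn2r ?nnegrE ?(ltW (half_pow_gt0 _ _))// lef_pV2 ?posrE ?ltr0n ?expn_gt0//.
    by rewrite ler_nat leq_exp2l.
  by lra.
have [G mG FG] := energy_complete (fun j => cmeasurable_fourier_integral (mf j)) cauchy.
have hp0 : (half_pow j ^+ 2)%:E @[j --> \oo] --> (0 : \bar R)%E.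
  by apply: cvg_EFin_real; exact: half_pow_sqr_cvg0.
exists G; split=> //.
  apply/cLfun2P; split=> //.
  apply: le_lt_trans (energy_le_approx leb mG (cmeasurable_fourier_integral (mf 0%N))) _.
  rewrite energyBC; apply: lte_add_pinfty; apply: lte_mul_pinfty => //.
    exact: le_lt_trans (FG 0%N) (ltry _).
  have [a b] := L12 0%N; apply: le_lt_trans (fourier_energy_le a b) _.
  by case/cLfun2P: b.
exists f; split=> //.
- apply/cvg_cLnorm2_energy; apply: (@squeeze_cvge _ _ _ _ (fun=> 0%E) _ (fun j => (half_pow j ^+ 2)%:E)) => //.
    apply: nearW => j; rewrite energy_ge0/= energyBC; apply: le_trans (hf j) _.
    by rewrite lee_fin ler_pdivrMr// ler_peMr ?sqr_ge0// ler1n.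
  exact: cvg_cst.
- apply/cvg_cLnorm2_energy; apply: (@squeeze_cvge _ _ _ _ (fun=> 0%E) _ (fun j => (half_pow j ^+ 2)%:E)) => //.
    by apply: nearW => j; rewrite energy_ge0/= FG.
  exact: cvg_cst.
Qed.

Lemma is_fourierL2_fourierL2 h : cLfun leb 2%:E h -> is_fourierL2 h (fourierL2 h).
Proof. by move=> Lh; apply: (xgetPex (fun=> 0)); exact: fourierL2_exists. Qed.

(** The upper Plancherel bound along the sequence that defines F; the factor 4
    comes from two uses of the triangle inequality for energies. *)
Lemma is_fourierL2_approx h F f : is_fourierL2 h F ->
  cLfun leb 1%:E f -> cLfun leb 2%:E f ->
  (energy leb (fun w => F w - fourier_integral f w)%R <=
   4%:E * energy leb (fun x => h x - f x)%R)%E.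
Proof.
move=> [Lh LF [h_ [L12 /cvg_cLnorm2_energy ch /cvg_cLnorm2_energy cF]]] f1 f2.
have [[mh _] [mF _] [mf _]] := And3 Lh LF f1.
apply/lee_addgt0Pr => e e0.
have e8 : 0 < e / 8 by rewrite divr_gt0.
near \oo => k.
have hk : (energy leb (fun x => h_ k x - h x)%R <= (e / 8)%:E)%E.
  by near: k; exact: cvge0_near_le.
have Fk : (energy leb (fun x => fourier_integral (h_ k) x - F x)%R <= (e / 8)%:E)%E.
  by near: k; exact: cvge0_near_le.
have [l1 l2] := L12 k; have [mk _] := l1.
have mhk := cmeasurable_fourier_integral mk.
have mff := cmeasurable_fourier_integral mf.
have -> : energy leb (fun w => F w - fourier_integral f w)%R =
    energy leb (fun w => (fourier_integral (h_ k) w - fourier_integral f w) -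
                         (fourier_integral (h_ k) w - F w))%R.
  by apply: eq_energy => w; ring.
apply: le_trans (energyB_le leb (cmeasurableB mhk mff) (cmeasurableB mhk mF)) _.
have E1 := energy_fourierB_le l1 l2 f1 f2.
have E2 : (energy leb (fun x => h_ k x - f x)%R <=
   2%:E * energy leb (fun x => h_ k x - h x)%R + 2%:E * energy leb (fun x => h x - f x)%R)%E.
  rewrite (energyBC leb h f).
  apply: le_trans (energyB_le leb (cmeasurableB mk mh) (cmeasurableB mf mh)).
  by rewrite le_eqVlt; apply/orP; left; apply/eqP/eq_energy => x; rewrite opprB addrA subrK.
have : energy leb (fun x => h x - f x)%R \is a fin_num by exact/energy_fin_num/cLfun2B.
move: E2 hk Fk E1.
move: (energy leb (fun x => h_ k x - h x)%R) (energy_ge0 leb (fun x => h_ k x - h x)%R) => A A0.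
move: (energy leb (fun x => h x - f x)%R) (energy_ge0 leb (fun x => h x - f x)%R) => B B0.
move: (energy leb (fun x => fourier_integral (h_ k) x - F x)%R)
  (energy_ge0 leb (fun x => fourier_integral (h_ k) x - F x)%R) => C C0.
move=> E2 hk Fk E1 Bf.
apply: (@le_trans _ _ (2%:E * (2%:E * (e / 8)%:E + 2%:E * B) + 2%:E * (e / 8)%:E)%E).
  apply: leeD; last by rewrite lee_pmul2l.
  rewrite lee_pmul2l//; apply: le_trans E1 _; apply: le_trans E2 _.
  by rewrite leeD// lee_pmul2l.
by case: B Bf B0 {E2} => // b _ _; rewrite -!(EFinM, EFinD) lee_fin; lra.
Unshelve. all: by end_near. Qed.

(** The lower Plancherel bound for approximants from the dense class passes to
    F by two uses of the triangle inequality for energies.  In particular the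
    transform of a nonzero function is nonzero. *)
Lemma is_fourierL2_energy h F : is_fourierL2 h F ->
  (energy leb h <= 4%:E * energy leb F)%E.
Proof.
move=> hF; have [Lh LF _] := hF; have [[mh _] [mF _]] := (Lh, LF).
apply/lee_addgt0Pr => e e0.
have e18 : 0 < e / 18 by rewrite divr_gt0.
have [f tf hf] := truncated_continuous_dense Lh e18.
have [f1 f2] := truncated_continuous_Lfun tf.
have [mf _] := f1; have mff := cmeasurable_fourier_integral mf.
apply: le_trans (energy_le_approx leb mh mf) _.
have E1 := energy_le_fourier tf.
have E2 := energy_le_approx leb mff mF.
have E3 := is_fourierL2_approx hF f1 f2.
rewrite energyBC in E2.
have := energy_fin_num LF.
move: hf E1 E2 E3.
move: (energy leb (fun x => h x - f x)%R) => A.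
move: (energy leb F) => B.
move: (energy leb (fun w => F w - fourier_integral f w)%R) => C.
move: (energy leb f) (energy leb (fourier_integral f)) => P Q.
move=> hf E1 E2 E3 Bf.
apply: (@le_trans _ _ (2%:E * (e / 18)%:E + 2%:E * (2%:E * (4%:E * (e / 18)%:E) + 2%:E * B))%E).
  rewrite leeD// lee_pmul2l// (le_trans E1)// (le_trans E2)// leeD//.
  by rewrite lee_pmul2l// (le_trans E3)// lee_pmul2l.
by case: B Bf {E2} => // b _; rewrite -!(EFinM, EFinD) lee_fin; lra.
Qed.

End fourierL2.

(** * The measure dr/r *)

Section haar.
Context {R : realType}.
Local Notation leb := (@lebesgue_measure R).
Local Notation haar := (@haar_pos R).

Let lnR : measurableTypeR R -> measurableTypeR R := @ln R.

Let measurable_lnR : measurable_fun setT lnR.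
Proof. exact: measurable_ln. Qed.

Let ln_ocitv_preimage (a b : R) :
  lnR @^-1` `]a, b]%classic `&` `]0, +oo[%classic = `]expR a, expR b]%classic.
Proof.
apply/seteqP; split => r; rewrite /lnR /= !in_itv/= ?andbT.
  move=> [/andP[ar rb] r0].
  by rewrite -(lnK r0) ltr_expR ler_expR ar rb.
move=> /andP[ar rb]; have r0 : 0 < r by exact: lt_trans (expR_gt0 _) ar.
by split=> //; move: ar rb; rewrite -{1 2}(lnK r0) ltr_expR ler_expR => -> ->.
Qed.

Let haar_ln_ocitv (a b : R) : haar (lnR @^-1` `]a, b]%classic) = leb `]a, b]%classic.
Proof.
rewrite lebesgue_measure_itv /= lte_fin /haar_pos ln_ocitv_preimage.
have [ab|ba] := ltP a b; last first.
  by rewrite set_itv_ge ?integral_set0// bnd_simp -leNgt ler_expR.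
have pos (r : R) : expR a <= r -> 0 < r by exact: lt_le_trans (expR_gt0 _).
have cinv (r : R) : 0 < r -> {for r, continuous (fun r : R => r^-1)}.
  by move=> r0; apply: inv_continuous; rewrite gt_eqF.
have cinv_within : {within `[expR a, expR b], continuous (fun r : R => r^-1)}.
  apply: continuous_in_subspaceT => r; rewrite inE/= in_itv/= => /andP[ar _].
  exact/cinv/pos.
have dln (r : R) : 0 < r -> is_derive r 1 (@ln R) r^-1 by exact: is_derive1_ln.
have cln (r : R) : 0 < r -> {for r, continuous (@ln R)}.
  move=> r0; have := dln _ r0 => ?.
  by apply: differentiable_continuous; apply/derivable1_diffP.
rewrite integral_itv_obnd_cbnd; last first.
  apply/measurable_EFinP; apply: measurable_funS (subspace_continuous_measurable_fun _ cinv_within) => //.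
  by apply: subset_itvr; rewrite bnd_simp.
rewrite (@continuous_FTC2 _ _ (@ln R)) ?ltr_expR//.
- by rewrite !expRK ?EFinB.
- split.
  + move=> r; rewrite in_itv/= => /andP[ar _].
    by have [] := dln _ (pos _ (ltW ar)).
  + by apply: cvg_at_right_filter; apply: cln; exact: expR_gt0.
  + by apply: cvg_at_left_filter; apply: cln; exact: expR_gt0.
- move=> r; rewrite in_itv/= => /andP[ar _].
  by have ? := dln _ (pos _ (ltW ar)); rewrite derive1E derive_val.
Qed.

Let haar_pos_Ny0 : haar `]-oo, 0%R]%classic = 0%E.
Proof.
rewrite /haar_pos (_ : _ `&` _ = set0) ?integral_set0//.
apply/seteqP; split => r //=; rewrite !in_itv/= andbT => -[r0 r1].
by have := le_lt_trans r0 r1; rewrite ltxx.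
Qed.

(** On the preimage of ]a, b] under the logarithm, dr/r integrates to b - a, so
    the logarithm carries it to Lebesgue measure. *)
Lemma ge0_integral_haar_pos (f : R -> \bar R) :
  measurable_fun setT (f : measurableTypeR R -> \bar R) -> (forall r, 0 <= f r)%E ->
  (\int[haar]_r f r = \int[leb]_x f (expR x))%E.
Proof.
move=> mf f0.
have mfe : measurable_fun setT (fun x : measurableTypeR R => f (expR x)).
  by apply: measurableT_comp => //; exact: measurable_expR.
transitivity (\int[pushforward haar lnR]_x f (expR x))%E; last first.
  apply: eq_measure_integral => A mA _; apply/esym/lebesgue_measure_unique => //.
  by move=> _ [[a b]] _ <- /=; rewrite /pushforward -haar_ln_ocitv.
rewrite (ge0_integral_pushforward measurable_lnR)//= preimage_setT.
apply: ge0_ae_eq_integral => //.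
- exact: (measurableT_comp mfe measurable_lnR).
- exists `]-oo, 0%R]%classic; split; first exact: measurable_itv.
    exact: haar_pos_Ny0.
  move=> r /= /not_implyP[_ H]; rewrite in_itv/= leNgt; apply/negP => r0.
  by apply: H; rewrite /lnR lnK.
Qed.

Lemma energy_haar_pos (g : measurableTypeR R -> R[i]) : cmeasurable g ->
  energy haar g = energy leb (fun x => g (expR x)).
Proof.
move=> mg; apply: (ge0_integral_haar_pos (f := fun r => (csq (g r))%:E)).
  exact: measurable_ecsq.
by move=> r; rewrite lee_fin csq_ge0.
Qed.

Lemma cmeasurable_expR (g : measurableTypeR R -> R[i]) : cmeasurable g ->
  cmeasurable (fun x : measurableTypeR R => g (expR x)).
Proof.
move=> [gR gI]; have me : measurable_fun setT (expR : measurableTypeR R -> measurableTypeR R).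
  exact: measurable_expR.
by split; [exact: (measurableT_comp gR me)|exact: (measurableT_comp gI me)].
Qed.

Lemma cLfun2_expR (g : measurableTypeR R -> R[i]) : cLfun haar 2%:E g ->
  cLfun leb 2%:E (fun x => g (expR x)).
Proof.
move=> /cLfun2P[mg gy]; apply/cLfun2P; split; first exact: cmeasurable_expR.
by rewrite -energy_haar_pos.
Qed.

End haar.

(** * Concentration in a time-frequency box *)

Section cutoff.
Context {R : realType}.
Local Notation leb := (@lebesgue_measure R).
Implicit Types h f F : measurableTypeR R -> R[i].

Definition cutoff (T : R) f (x : measurableTypeR R) : R[i] :=
  if `|x| <= T then f x else 0.

Let measurable_in_cutoff (T : R) :
  measurable_fun setT (fun x : measurableTypeR R => `|x| <= T).
Proof. by apply: measurable_fun_ler => //; exact: measurableT_comp. Qed.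

Lemma cmeasurable_cutoff T f : cmeasurable f -> cmeasurable (cutoff T f).
Proof.
move=> [fR fI]; split.
  rewrite (_ : (fun _ => _) = (fun x : measurableTypeR R =>
      if `|x| <= T then complex.Re (f x) else 0)).
    exact: measurable_fun_ifT.
  by apply/funext => x; rewrite /cutoff; case: ifP.
rewrite (_ : (fun _ => _) = (fun x : measurableTypeR R =>
    if `|x| <= T then complex.Im (f x) else 0)).
  exact: measurable_fun_ifT.
by apply/funext => x; rewrite /cutoff; case: ifP.
Qed.

Lemma cutoffB T f h x : cutoff T (fun x => f x - h x) x = cutoff T f x - cutoff T h x.
Proof. by rewrite /cutoff; case: ifP; rewrite ?subr0. Qed.

Lemma energy_cutoff_le T f : cmeasurable f ->
  (energy leb (cutoff T f) <= energy leb f)%E.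
Proof.
move=> mf; apply: ge0_le_integral => //.
- by move=> x _; rewrite lee_fin csq_ge0.
- by apply: measurable_ecsq; exact: cmeasurable_cutoff.
- exact: measurable_ecsq.
- by move=> x _; rewrite lee_fin /cutoff; case: ifP; rewrite ?csq0 ?csq_ge0.
Qed.

Lemma cLfun2_cutoff T f : cLfun leb 2%:E f -> cLfun leb 2%:E (cutoff T f).
Proof.
move=> /cLfun2P[mf fy]; apply/cLfun2P; split; first exact: cmeasurable_cutoff.
exact: le_lt_trans (energy_cutoff_le T mf) fy.
Qed.

Lemma integral_cutoff_cst (T M : R) : 0 <= T -> 0 <= M ->
  (\int[leb]_x (if `|x| <= T then M else 0)%:E = (M * (2 * T))%:E)%E.
Proof.
move=> T0 M0; pose I : set (measurableTypeR R) := `[- T, T]%classic.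
have mI : measurable I by exact: measurable_itv.
transitivity (\int[leb]_(x in I) M%:E)%E.
  rewrite [RHS]integral_mkcond; apply: eq_integral => x _; rewrite patchE.
  by rewrite /I mem_setE in_itv/= -ler_norml; case: ifP.
rewrite integral_cst// EFinM; congr (_ * _)%E.
transitivity ((@lebesgue_measure R) I) => //.
rewrite /I lebesgue_measure_itv/= lte_fin; case: ifPn => [_|].
  by rewrite -EFinB; congr EFin; ring.
rewrite -leNgt => TT; congr EFin; lra.
Qed.

Lemma cLfun1_cutoff T f : 0 <= T -> cLfun leb 2%:E f -> cLfun leb 1%:E (cutoff T f).
Proof.
move=> T0 /cLfun2P[mf fy]; split; first exact: cmeasurable_cutoff.
have mc : measurable_fun setT (fun x : measurableTypeR R => (if `|x| <= T then 1 else 0 : R)%:E).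
  by apply/measurable_EFinP; exact: measurable_fun_ifT.
rewrite cLnorm1E; apply: (@le_lt_trans _ _
    (\int[leb]_x ((if `|x| <= T then 1 else 0 : R)%:E + (csq (f x))%:E))%E).
  apply: ge0_le_integral => //.
  - by move=> x _; rewrite lee_fin cmod_ge0.
  - by apply/measurable_EFinP; apply: measurable_cmod; exact: cmeasurable_cutoff.
  - by apply: emeasurable_funD => //; exact: measurable_ecsq.
  - move=> x _; rewrite -EFinD lee_fin /cutoff; case: ifP => _; last first.
      by rewrite add0r /= expr0n addr0 sqrtr0 csq_ge0.
    by rewrite -sqr_cmod; have := sqr_ge0 (cmod (f x) - 1); have := cmod_ge0 (f x); nra.
rewrite ge0_integralD//.
- by rewrite integral_cutoff_cst// lte_add_pinfty// ltry.
- by move=> x _; rewrite lee_fin; case: ifP.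
- by move=> x _; rewrite lee_fin csq_ge0.
- exact: measurable_ecsq.
Qed.

Definition wave (T w : R) : measurableTypeR R -> R[i] :=
  cutoff T (fun x => cexpi (2 * pi * w * x)).

Lemma cmeasurable_wave T w : cmeasurable (wave T w).
Proof. by apply: cmeasurable_cutoff; apply: cmeasurable_cexpi; exact: measurable_funM. Qed.

Lemma energy_wave T w : 0 <= T -> energy leb (wave T w) = (2 * T)%:E.
Proof.
move=> T0; have := integral_cutoff_cst T0 (@ler01 R); rewrite mul1r => <-.
by apply: eq_integral => x _; rewrite /wave /cutoff; case: ifP; rewrite ?csq_cexpi ?csq0.
Qed.

Lemma cLfun2_wave T w : 0 <= T -> cLfun leb 2%:E (wave T w).
Proof.
by move=> T0; apply/cLfun2P; split; [exact: cmeasurable_wave|rewrite energy_wave// ltry].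
Qed.

Lemma fourier_integral_cutoff T h w :
  fourier_integral (cutoff T h) w = cdot leb h (wave T w).
Proof.
have E x : cutoff T h x * cexpi (- (2 * pi * w * x)) = h x * conjc (wave T w x).
  rewrite /wave /cutoff; case: ifP => _; last by rewrite conjc0 mulr0 mul0r.
  by congr (_ * _); rewrite /cexpi /= cosN sinN.
rewrite /fourier_integral /cdot /cintegral; congr Complex.
  by apply: eq_Rintegral => x _; rewrite E.
by apply: eq_Rintegral => x _; rewrite E.
Qed.

(** Bessel's inequality against the truncated waves, integrated over a window
    of frequencies: the time-frequency box [-T, T]^2 has a finite capacity. *)
Lemma time_frequency_capacity (T B : R) (s : seq nat) (h : nat -> measurableTypeR R -> R[i]) :
  0 <= T -> 0 < B -> (forall n, n \in s -> cLfun leb 2%:E (h n)) ->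
  (forall c : nat -> R[i], fine (energy leb (fun x => \sum_(n <- s) c n * h n x)) <=
     B * \sum_(n <- s) csq (c n)) ->
  (\sum_(n <- s) energy leb (cutoff T (fourier_integral (cutoff T (h n))))
     <= (B * (2 * T) * (2 * T))%:E)%E.
Proof.
move=> T0 B0 Lh bound.
rewrite big_seq /energy.
have mF n : n \in s -> cmeasurable (cutoff T (fourier_integral (cutoff T (h n)))).
  move=> ns; apply: cmeasurable_cutoff; apply: cmeasurable_fourier_integral.
  by apply: cmeasurable_cutoff; case: (Lh n ns).
pose G n w : R := if n \in s then csq (cutoff T (fourier_integral (cutoff T (h n))) w) else 0.
have mG n : measurable_fun setT (G n).
  rewrite /G; case ns: (n \in s); last exact: measurable_cst.
  exact: measurable_csq (mF n ns).
have -> : (\sum_(n <- s | n \in s)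
    \int[leb]_x (csq (cutoff T (fourier_integral (cutoff T (h n))) x))%:E)%E =
    (\sum_(n <- s) \int[leb]_w (G n w)%:E)%E.
  rewrite [RHS]big_seq; apply: eq_bigr => n ns; apply: eq_integral => w _.
  by rewrite /G ns.
have G0 n w : 0 <= G n w by rewrite /G; case: ifP => _ //; exact: csq_ge0.
have mEG n : measurable_fun setT (fun w => (G n w)%:E) by apply/measurable_EFinP; exact: mG.
rewrite -ge0_integral_sum//; last by move=> n w _; rewrite lee_fin.
rewrite -integral_cutoff_cst ?mulr_ge0 ?(ltW B0)//.
apply: ge0_le_integral => //.
- by move=> w _; apply: sume_ge0 => n _; rewrite lee_fin.
- by apply: emeasurable_sum => n; exact: mEG.
- by apply/measurable_EFinP; apply: measurable_fun_ifT.
- move=> w _; rewrite sumEFin lee_fin; case: ifPn => wT; last first.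
    rewrite big1 // => n _; rewrite /G; case: ifP => // _.
    by rewrite /cutoff (negbTE wT) csq0.
  apply: le_trans (_ : B * fine (energy leb (wave T w)) <= _); last by rewrite energy_wave.
  apply: le_trans (bessel B0 Lh bound (cLfun2_wave w T0)).
  rewrite big_seq [leRHS]big_seq ler_sum// => n ns.
  by rewrite /G ns {1}/cutoff wT fourier_integral_cutoff.
Qed.

End cutoff.

Section concentration.
Context {R : realType}.
Local Notation leb := (@lebesgue_measure R).
Local Notation haar := (@haar_pos R).
Local Notation plane := (measurableTypeR R * measurableTypeR R)%type.

Lemma ge0_integral_tensor (a b : measurableTypeR R -> R) :
  measurable_fun setT a -> measurable_fun setT b ->
  (forall x, 0 <= a x) -> (forall x, 0 <= b x) ->
  (\int[leb \x haar]_z (a z.1 * b z.2)%:E =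
   (\int[leb]_x (a x)%:E) * (\int[haar]_y (b y)%:E))%E.
Proof.
move=> ma mb a0 b0; rewrite fubini_tonelli1; last 2 first.
- apply/measurable_EFinP; apply: measurable_funM.
    exact: (measurable_fst_comp ma).
  exact: (measurable_snd_comp mb).
- by move=> z; rewrite lee_fin mulr_ge0.
rewrite -ge0_integralZr//; last 3 first.
- exact/measurable_EFinP.
- by move=> x _; rewrite lee_fin.
- by apply: integral_ge0 => y _; rewrite lee_fin.
apply: eq_integral => x _; rewrite /fubini_F /=.
under eq_integral do rewrite EFinM.
rewrite ge0_integralZl_EFin//.
- by move=> y _; rewrite lee_fin.
- exact/measurable_EFinP.
Qed.

Definition outside (T : R) (z : plane) : bool := (T < `|z.1|) || (T < `|ln z.2|).

Definition tail_energy (phi : plane -> R[i]) (T : R) : \bar R :=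
  (\int[leb \x haar]_z (if outside T z then csq (phi z) else 0)%:E)%E.

Let measurable_outside (T : R) : measurable_fun setT (outside T).
Proof.
apply: measurable_or.
  apply: measurable_fun_ltr => //; apply: measurableT_comp => //.
apply: measurable_fun_ltr => //; apply: measurableT_comp => //.
by apply: measurableT_comp => //; exact: measurable_ln.
Qed.

(** The regions decrease to the empty set. *)
Lemma tail_energy_cvg0 phi : cLfun (leb \x haar)%E 2%:E phi ->
  tail_energy phi k%:R @[k --> \oo] --> (0 : \bar R)%E.
Proof.
move=> Lphi; have [mphi _] := Lphi.
rewrite (_ : 0%E = (\int[leb \x haar]_x (cst 0 x))%E); last by rewrite integral0.
apply: (@dominated_cvg _ _ _ (leb \x haar)%E setT measurableT _ _ (fun z => (csq (phi z))%:E)) => //.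
- move=> k; apply/measurable_EFinP; apply: measurable_fun_ifT => //.
  exact: measurable_csq.
- move=> z _; apply: cvg_EFin_real; apply: cvg_near_cst.
  near=> k; rewrite /outside ifF//; apply/negbTE; rewrite negb_or -!leNgt.
  by apply/andP; split; near: k; exact: nbhs_infty_ger.
- exact: integrable_csq.
- by move=> k z _; rewrite lee_fin; case: ifP => _; rewrite ger0_norm ?csq_ge0// normr0.
Unshelve. all: by end_near. Qed.

Lemma csq_mellin_rihaczek (g : measurableTypeR R -> R[i]) (w r : R) :
  csq (mellin_rihaczek g w r) = csq (mellin g w) * csq (g r).
Proof. by rewrite /mellin_rihaczek !csqM csq_cexpi mul1r csq_conjc mulrC. Qed.

(** Tonelli turns the product of the two energies into an integral over the
    plane, where the domination applies. *)
Lemma energyM_le_tail (g F' g' : measurableTypeR R -> R[i]) (phi : plane -> R[i]) (T : R) :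
  cmeasurable F' -> cmeasurable g' -> cmeasurable phi ->
  {ae (leb \x haar)%E, forall z,
     cmod (mellin_rihaczek g z.1 z.2) <= cmod (phi z)} ->
  (forall w r, csq (F' w) * csq (g' r) <=
     (if outside T (w, r) then csq (mellin g w) * csq (g r) else 0)) ->
  (energy leb F' * energy haar g' <= tail_energy phi T)%E.
Proof.
move=> mF mg mphi dom FG.
rewrite /energy -ge0_integral_tensor; try exact: measurable_csq; try by move=> ?; exact: csq_ge0.
apply: ae_ge0_le_integral => //.
- by move=> z _; rewrite lee_fin mulr_ge0 ?csq_ge0.
- apply/measurable_EFinP; apply: measurable_funM.
    exact: (measurable_fst_comp (measurable_csq mF)).
  exact: (measurable_snd_comp (measurable_csq mg)).
- by move=> z _; rewrite lee_fin; case: ifP => // _; exact: csq_ge0.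
- apply/measurable_EFinP; apply: measurable_fun_ifT => //.
  exact: measurable_csq.
- have [N [mN N0 domN]] := dom; exists N; split=> //.
  move=> [w r] /= nwr; apply: domN => /= h; apply: nwr => _.
  rewrite lee_fin (le_trans (FG w r))//.
  case: ifP => // _; rewrite -csq_mellin_rihaczek -!sqr_cmod.
  by rewrite ler_pXn2r ?nnegrE ?cmod_ge0.
Qed.

(** The energy of the Mellin transform F is at least a quarter of that of h,
    hence c / 4.  Cutting F to [-T, T] and replacing it there by the transform of
    the truncation of h changes this by multiples of the frequency tail and of
    the time tail, each of which is at most the tail of phi divided by a multiple
    of c; the threshold c^2 / 528 leaves c / 32. *)
Lemma concentration_lower (g : measurableTypeR R -> R[i]) (phi : plane -> R[i]) (T c : R) :
  0 <= T -> 0 < c -> cLfun haar 2%:E g -> cmeasurable phi ->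
  c <= fine (energy haar g) ->
  {ae (leb \x haar)%E, forall z,
     cmod (mellin_rihaczek g z.1 z.2) <= cmod (phi z)} ->
  (tail_energy phi T <= (c ^+ 2 / 528)%:E)%E ->
  ((c / 32)%:E <= energy leb (cutoff T (fourier_integral (cutoff T (fun x => g (expR x))))))%E.
Proof.
move=> T0 c0 Lg mphi cg dom tail.
have [mg _] := Lg.
pose h (x : measurableTypeR R) := g (expR x).
have Lh : cLfun leb 2%:E h by exact: cLfun2_expR.
have [mh _] := Lh.
pose F := mellin g.
have hF : is_fourierL2 h F by exact: is_fourierL2_fourierL2.
have LF : cLfun leb 2%:E F by case: hF.
have [mF _] := LF.
have mcF := cmeasurable_cutoff T mF.
have mch := cmeasurable_cutoff T mh.
(* frequency tail: g is kept, and F is replaced by its part outside [-T, T] *)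
have tw : (energy leb (fun w => F w - cutoff T F w)%R * energy haar g <= (c ^+ 2 / 528)%:E)%E.
  apply: le_trans tail; apply: (energyM_le_tail (cmeasurableB mF mcF) mg mphi dom).
  move=> w r; rewrite /cutoff /outside /=; have [wT|wT] := leP `|w| T => /=.
    by rewrite subrr csq0 mul0r; case: ifP => // _; rewrite mulr_ge0 ?csq_ge0.
  by rewrite subr0.
(* time tail: F is kept, and g is replaced by its part where |ln r| > T *)
have tx : (energy leb F * energy leb (fun x => h x - cutoff T h x)%R <= (c ^+ 2 / 528)%:E)%E.
  pose g' (r : measurableTypeR R) : R[i] := if `|ln r| <= T then 0 else g r.
  have mb : measurable_fun setT (fun r : measurableTypeR R => `|ln r| <= T).
    by apply: measurable_fun_ler => //; apply: measurableT_comp.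
  have mg' : cmeasurable g'.
    have [gR gI] := mg; split.
      rewrite (_ : (fun _ => _) = (fun r : measurableTypeR R =>
          if `|ln r| <= T then 0 else complex.Re (g r))).
        exact: measurable_fun_ifT.
      by apply/funext => r; rewrite /g'; case: ifP.
    rewrite (_ : (fun _ => _) = (fun r : measurableTypeR R =>
        if `|ln r| <= T then 0 else complex.Im (g r))).
      exact: measurable_fun_ifT.
    by apply/funext => r; rewrite /g'; case: ifP.
  have -> : energy leb (fun x => h x - cutoff T h x)%R = energy haar g'.
    rewrite energy_haar_pos//; apply: eq_energy => x.
    by rewrite /g' /h /cutoff expRK; case: ifP; rewrite ?subrr ?subr0.
  apply: le_trans tail; apply: (energyM_le_tail mF mg' mphi dom).
  move=> w r; rewrite /g' /outside /=; have [rT|rT] := leP `|ln r| T => /=.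
    by rewrite csq0 mulr0; case: ifP => // _; rewrite mulr_ge0 ?csq_ge0.
  by rewrite orbT.
have ha : energy haar g = energy leb h by exact: energy_haar_pos.
have E1 := is_fourierL2_energy hF.
have Lch := cLfun2_cutoff T Lh.
have L1ch := cLfun1_cutoff T0 Lh.
have E2 := is_fourierL2_approx hF L1ch Lch.
pose Q := fourier_integral (cutoff T h).
have mQ : cmeasurable Q by exact: cmeasurable_fourier_integral.
have E3 := energy_le_approx leb mF mcF.
have E4 : (energy leb (cutoff T F) <= 2%:E * energy leb (fun w => F w - Q w)%R +
    2%:E * energy leb (cutoff T Q))%E.
  apply: le_trans (energy_le_approx leb mcF (cmeasurable_cutoff T mQ)) _.
  rewrite leeD2r// lee_pmul2l//.
  apply: le_trans (energy_cutoff_le T (cmeasurableB mF mQ)).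
  by rewrite le_eqVlt; apply/orP; left; apply/eqP/eq_energy => w; rewrite cutoffB.
have fa := energy_fin_num Lg.
have fb := energy_fin_num LF.
have ftw : energy leb (fun w => F w - cutoff T F w)%R \is a fin_num.
  by apply: energy_fin_num; apply: cLfun2B => //; exact: cLfun2_cutoff.
have ftx : energy leb (fun x => h x - cutoff T h x)%R \is a fin_num.
  by apply/energy_fin_num/cLfun2B.
rewrite -/h -/Q.
have qy : energy leb (cutoff T Q) \is a fin_num.
  apply: energy_fin_num; apply: cLfun2_cutoff; apply/cLfun2P; split=> //.
  by apply: le_lt_trans (fourier_energy_le L1ch Lch) _; case/cLfun2P: Lch.
have t1 := energy_ge0 leb (fun w => F w - cutoff T F w)%R.
have t2 := energy_ge0 leb (fun x => h x - cutoff T h x)%R.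
have {E2 E3 E4} E : (energy leb F <= 2%:E * energy leb (fun w => F w - cutoff T F w)%R +
   2%:E * (2%:E * (4%:E * energy leb (fun x => h x - cutoff T h x)%R) +
    2%:E * energy leb (cutoff T Q)))%E.
  apply: le_trans E3 _; rewrite leeD2l// lee_pmul2l//.
  by apply: le_trans E4 _; rewrite leeD2r// lee_pmul2l.
rewrite -ha in E1; move: fa fb ftw ftx qy t1 t2 E E1 tw tx cg.
case: (energy haar g) => // a _; case: (energy leb F) => // b _.
case: (energy leb (fun w => F w - cutoff T F w)%R) => // tw _.
case: (energy leb (fun x => h x - cutoff T h x)%R) => // tx _.
case: (energy leb (cutoff T Q)) => // q _.
rewrite -!(EFinM, EFinD) !lee_fin /= => tw0 tx0 E E1 Etw Etx ca.
have b4 : c / 4 <= b by lra.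
have tw1 : tw <= c / 528.
  have : tw * c <= c ^+ 2 / 528 by apply: le_trans Etw; rewrite ler_wpM2l.
  by rewrite (_ : c ^+ 2 / 528 = c / 528 * c) ?ler_pM2r//; ring.
have tx1 : tx <= c / 132.
  have : c / 4 * tx <= c ^+ 2 / 528 by apply: le_trans Etx; rewrite ler_wpM2r.
  rewrite (_ : c ^+ 2 / 528 = c / 4 * (c / 132)); first by rewrite ler_pM2l// divr_gt0.
  by field.
lra.
Qed.

End concentration.

Unset Implicit Arguments.

Theorem corollary4p10 (R : realType)
    (phi : measurableTypeR R * measurableTypeR R -> R[i])
    (hphi : cLfun (@lebesgue_measure R \x @haar_pos R)%E 2%:E phi)
    (J : set nat) (g : nat -> measurableTypeR R -> R[i])
    (hg : orthonormal_sequence (@haar_pos R) J g \/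
          riesz_sequence (@haar_pos R) J g)
    (hdom : forall n, J n ->
       {ae (@lebesgue_measure R \x @haar_pos R)%E, forall z,
         cmod (mellin_rihaczek (g n) z.1 z.2) <= cmod (phi z)}) :
  finite_set J.
Proof.
have rg : riesz_sequence (@haar_pos R) J g.
  by case: hg => // og; exact: orthonormal_riesz.
have [Lg _] := rg.
have [B B0 upper] := riesz_upper_bound rg.
have [c c0 lower] := riesz_lower_bound rg.
have [mphi _] := hphi.
have e0 : 0 < c ^+ 2 / 528 by rewrite divr_gt0// exprn_gt0.
have [T T0 tail] : exists2 T : R, 0 <= T & (tail_energy phi T <= (c ^+ 2 / 528)%:E)%E.
  near \oo => k; exists k%:R => //.
  by near: k; exact: (cvge0_near_le (tail_energy_cvg0 hphi)).
pose h n (x : measurableTypeR R) := g n (expR x).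
apply: contrapT => Jinf.
(* each index uses at least c / 32 of the total capacity *)
pose N := (Num.truncn (B * (2 * T) * (2 * T) / (c / 32))).+1.
have [s sJ sN] := infinite_set_fset N Jinf.
have sJ' n : n \in enum_fset s -> J n by move=> ns; exact: sJ.
have us : uniq (enum_fset s) by exact: fset_uniq.
have bound (d : nat -> R[i]) :
    fine (energy (@lebesgue_measure R) (fun x => \sum_(n <- enum_fset s) d n * h n x)) <=
    B * \sum_(n <- enum_fset s) csq (d n).
  apply: le_trans (upper _ d us sJ').
  have Ls : cLfun (@haar_pos R) 2%:E (fun r => \sum_(n <- enum_fset s) d n * g n r).
    by apply: cLfun2_sum => n ns; apply: cLfun2Z; exact/Lg/sJ'.
  by rewrite (energy_haar_pos Ls.1).
have cap := time_frequency_capacity T0 B0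
  (fun n ns => cLfun2_expR (Lg _ (sJ' n ns))) bound.
have : (\sum_(n <- enum_fset s) (c / 32)%:E <= (B * (2 * T) * (2 * T))%:E)%E.
  apply: le_trans cap; rewrite big_seq [leRHS]big_seq lee_sum// => n ns.
  have Jn := sJ' n ns.
  exact: (concentration_lower T0 c0 (Lg _ Jn) mphi (lower _ Jn) (hdom _ Jn) tail).
rewrite sumEFin lee_fin big_const_seq count_predT iter_addr_0 => H.
have c32 : 0 < c / 32 by rewrite divr_gt0.
have : (size (enum_fset s))%:R <= B * (2 * T) * (2 * T) / (c / 32).
  by rewrite ler_pdivlMr// [leLHS]mulr_natl.
apply/negP; rewrite -ltNge; apply: lt_le_trans (truncnS_gt _) _.
by rewrite ler_nat.
Unshelve. all: by end_near. Qed.
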